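(* Let $K\ge1$, $K'\ge0$, and let $f=h+\overline{g}$ (with $h,g$ analytic in $\mathbb{D}$, $g(0)=0$) be a $(K,K')$-elliptic harmonic mapping in $\mathbb{D}$ with $f(0)=0$ and $J_f(0)=1$. Then $f(\mathbb{D})$ contains a univalent disk of radius at least $$\rho_2=\frac{1}{\sqrt{2(K+K')}}\left(1+t(K,K')\ln\left(\frac{t(K,K')}{1+t(K,K')}\right)\right),$$ where $$t(K,K')=2K+\frac{4K'(K+K')-1}{K+\sqrt{K^2+4K'(K+K')}}.$$
   Context: $\mathbb{D}$ is the open unit disk in $\mathbb{C}$. A disk $\Omega$ is called a univalent disk in $f(\mathbb{D})$ if there exists a domain $\Delta\subseteq\mathbb{D}$ such that $f$ maps $\Delta$ univalently (injectively) onto $\Omega$. For a continuously differentiable $f=u+iv$ with $z=x+iy$: $f_z=\frac12(f_x-if_y)$, $f_{\bar z}=\frac12(f_x+if_y)$, and the Jacobian is $J_f=|f_z|^2-|f_{\bar z}|^2$. $D_f=\begin{pmatrix}u_x&u_y\\ v_x&v_y\end{pmatrix}$, and for a real $2\times2$ matrix $A$, $\|A\|=\sup\{|Az|:|z|=1\}$. A sense-preserving continuous mapping $f$ from $\mathbb{D}$ into $\mathbb{C}$ is $(K,K')$-elliptic (with $K\ge1$, $K'\ge0$) if: (i) $f$ is absolutely continuous on lines in $\mathbb{D}$, i.e., for every closed rectangle $R\subset\mathbb{D}$, $f$ is absolutely continuous on almost every line segment in $R$ parallel to the coordinate axes; (ii) $f_z,f_{\bar z}\in L^2(\mathbb{D})$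 and $J_f\ne0$ a.e. in $\mathbb{D}$; (iii) $\|D_f\|^2\le KJ_f+K'$ a.e. in $\mathbb{D}$. A mapping $f$ is harmonic on $\mathbb{D}$ if it is twice continuously differentiable and $4f_{z\bar z}=0$ there. A $(K,K')$-elliptic harmonic mapping is a harmonic mapping that is $(K,K')$-elliptic. *)

(* Defs.v *)
From HB Require Import structures.
From mathcomp Require Import all_boot all_order all_algebra.
From mathcomp Require Import complex.
From mathcomp Require Import all_classical all_reals all_analysis.

Set Implicit Arguments.
Unset Strict Implicit.
Unset Printing Implicit Defensive.

Import Order.TTheory GRing.Theory Num.Theory.
Import ComplexField.Normc.
Import numFieldNormedType.Exports.

Local Open Scope classical_set_scope.
Local Open Scope ring_scope.
Local Open Scope complex_scope.

(* The alias _^o is what gives R[i] its norm topology and its structure of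
   normed space over itself, so that [derivable _ z 1] below is complex
   differentiability. *)
Notation cplx R := (R[i])^o.

Section PlaneDomains.
Variable R : realType.
Local Notation C := (cplx R).

Definition disk (w : C) (r : R) : set C := ball w r%:C.

Definition unit_disk : set C := disk 0 1.

Definition domain (A : set C) : Prop := [/\ open A, connected A & A !=set0].

Definition univalent_disk (D : set C) (f : C -> C) (w : C) (r : R) : Prop :=
  0 < r /\
  exists Delta : set C,
    [/\ Delta `<=` D, domain Delta & set_bij Delta (disk w r) f].

Definition analytic_on (A : set C) (h : C -> C) : Prop :=
  forall z, A z -> derivable h z 1.

End PlaneDomains.

Section Differentiation.
Variable R : realType.
Local Notation C := (cplx R).
Implicit Types (u : C -> R) (f : C -> C) (z : C).

(* Restrictions of u to the horizontal and to the vertical line through z. *)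
Definition line_x u z : R -> R := fun s => u (s +i* complex.Im z).
Definition line_y u z : R -> R := fun s => u (complex.Re z +i* s).

Definition part_x u z : R := derive1 (line_x u z) (complex.Re z).
Definition part_y u z : R := derive1 (line_y u z) (complex.Im z).

Definition re_part f : C -> R := fun z => complex.Re (f z).
Definition im_part f : C -> R := fun z => complex.Im (f z).

Definition cpart_x f : C -> C :=
  fun z => part_x (re_part f) z +i* part_x (im_part f) z.
Definition cpart_y f : C -> C :=
  fun z => part_y (re_part f) z +i* part_y (im_part f) z.

Definition C1_on (A : set C) f : Prop := forall z, A z ->
  [/\ derivable (line_x (re_part f) z) (complex.Re z) 1
        /\ derivable (line_y (re_part f) z) (complex.Im z) 1,
      derivable (line_x (im_part f) z) (complex.Re z) 1
        /\ derivable (line_y (im_part f) z) (complex.Im z) 1,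
      {for z, continuous (cpart_x f)}
    & {for z, continuous (cpart_y f)}].

Definition C2_on (A : set C) f : Prop :=
  [/\ C1_on A f, C1_on A (cpart_x f) & C1_on A (cpart_y f)].

Definition dz f : C -> C :=
  fun z => 2^-1 * (cpart_x f z - 'i%C * cpart_y f z).
Definition dzbar f : C -> C :=
  fun z => 2^-1 * (cpart_x f z + 'i%C * cpart_y f z).

Definition Jac f z : R := normc (dz f z) ^+ 2 - normc (dzbar f z) ^+ 2.

Definition diff_mx f z : 'M[R]_2 :=
  \matrix_(i < 2, j < 2)
    nth 0 (nth [::]
      [:: [:: part_x (re_part f) z; part_y (re_part f) z];
          [:: part_x (im_part f) z; part_y (im_part f) z]] i) j.

(* The library's norm on matrices is the max norm, hence the following two. *)
Definition euclid (w : 'cV[R]_2) : R := Num.sqrt (\sum_i w i 0 ^+ 2).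
Definition opnorm (A : 'M[R]_2) : R :=
  sup [set euclid (A *m w) | w in [set w | euclid w = 1]].

Definition harmonic_on (A : set C) f : Prop :=
  C2_on A f /\ forall z, A z -> 4 * dzbar (dz f) z = 0.

End Differentiation.

Section SensePreserving.
Variable R : realType.
Local Notation C := (cplx R).

Definition expi (t : R) : C := cos t +i* sin t.

(* n is the winding number about w of the loop gamma : [0, 2 pi] -> C, read off
   from a continuous determination theta of the argument of gamma - w. *)
Definition winding_number (gamma : R -> C) (w : C) (n : int) : Prop :=
  exists theta : R -> R,
    [/\ {within `[0, 2 * pi], continuous theta},
        forall t, t \in `[0, 2 * pi] -> gamma t != w /\
          gamma t - w = (normc (gamma t - w))%:C * expi (theta t)
      & theta (2 * pi) - theta 0 = n%:~R * (2 * pi)].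

(* Positivity of the topological degree, the meaning of "sense-preserving" for
   maps that are only continuous: the degree over the disk of center z0 and
   radius r, at a value w which is not taken on the bounding circle, is the
   winding number about w of the image of that circle. *)
Definition sense_preserving (A : set C) (f : C -> C) : Prop :=
  forall (z0 : C) (r : R) (w : C), 0 < r ->
    (forall z, normc (z - z0) <= r -> A z) ->
    (forall z, normc (z - z0) = r -> f z != w) ->
    (f @` disk z0 r) w ->
    exists2 n : int, 0 < n & winding_number (fun t => f (z0 + r%:C * expi t)) w n.

End SensePreserving.

Section Elliptic.
Variable R : realType.
Local Notation C := (cplx R).
Local Notation mu := (@lebesgue_measure R).

Definition abs_continuous (a b : R) (gamma : R -> C) : Prop :=
  forall eps : R, 0 < eps -> exists2 delta : R, 0 < delta &
    forall (n : nat) (s t : 'I_n -> R),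
      (forall i, [/\ a <= s i, s i <= t i & t i <= b]) ->
      trivIset setT (fun i => [set` `]s i, t i[]) ->
      \sum_i (t i - s i) < delta ->
      \sum_i normc (gamma (t i) - gamma (s i)) < eps.

Definition ACL (A : set C) (f : C -> C) : Prop :=
  forall a b c d : R, a < b -> c < d ->
    (forall x y, x \in `[a, b] -> y \in `[c, d] -> A (x +i* y)) ->
    {ae mu, forall y, y \in `[c, d] -> abs_continuous a b (fun x => f (x +i* y))}
    /\
    {ae mu, forall x, x \in `[a, b] -> abs_continuous c d (fun y => f (x +i* y))}.

Local Notation mu2 := (mu \x mu)%E.

Definition to_cplx (p : R * R) : C := p.1 +i* p.2.

Definition ae_on (A : set C) (P : C -> Prop) : Prop :=
  {ae mu2, forall p, A (to_cplx p) -> P (to_cplx p)}.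

Definition L2_on (A : set C) (f : C -> C) : Prop :=
  let A' := to_cplx @^-1` A in
  [/\ measurable_fun A' (re_part f \o to_cplx),
      measurable_fun A' (im_part f \o to_cplx)
    & (\int[mu2]_(p in A') (normc (f (to_cplx p)) ^+ 2)%:E < +oo)%E].

Definition elliptic (K K' : R) (f : C -> C) : Prop :=
  let D := @unit_disk R in
  [/\ (forall z, D z -> {for z, continuous f}) /\ sense_preserving D f,
      ACL D f,
      [/\ L2_on D (dz f), L2_on D (dzbar f) & ae_on D (fun z => Jac f z != 0)]
    & ae_on D (fun z => opnorm (diff_mx f z) ^+ 2 <= K * Jac f z + K')].

End Elliptic.

Section Constants.
Variable R : realType.

Definition tKK (K K' : R) : R :=
  2 * K + (4 * K' * (K + K') - 1) /
          (K + Num.sqrt (K ^+ 2 + 4 * K' * (K + K'))).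

Definition rho2 (K K' : R) : R :=
  (Num.sqrt (2 * (K + K')))^-1 *
  (1 + tKK K K' * ln (tKK K K' / (1 + tKK K K'))).

End Constants.

(* Main.v *)
(* Write f = h + conj g, L = |h'| + |g'| and l = |h'| - |g'|, so that J_f = L l and
   ellipticity reads L^2 <= K L l + K'. By continuity this holds on the whole
   disk, and at 0 it gives l(0) >= 1 / sqrt(K + K').

   Bloch's argument: if (1 - |z|^2) l(z) is maximal at a, precompose f with the
   disk automorphism moving 0 to a, restricted to the disk of radius 1 / sqrt 2.
   For the resulting map F = H + conj G on the unit disk, l_F <= 2 l_F(0), hence
   L_F <= S l_F(0) with S = K + sqrt(K^2 + 4 K' (K + K')), and
   l_F(0) >= 1 / sqrt(2 (K + K')). If the supremum of (1 - |z|^2) l(z) exceeds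
   l(0), some f(rho z) with rho < 1 has an interior maximum at least as large as
   l(0); otherwise a = 0 will do.

   Landau's argument, with t = S - 1/S = t(K, K'): the Schwarz-Pick lemma applied
   to H' + e G', |e| = 1, bounds |H'(z) - H'(0)| + |G'(z) - G'(0)| by
   l_F(0) t |z| / (1 - |z|). Hence for |z| < 1 / (1 + t) the map F is a small
   perturbation of its differential at 0, so it is injective and open there, and
   integrating the bound along radii gives the radius of the covered disk.

   The Schwarz-Pick lemma needs no integral formula: the maximum principle is
   applied to difference quotients, for which order 2 Taylor expansions suffice. *)
Require Import Defs.
From HB Require Import structures.
From mathcomp Require Import all_boot all_order all_algebra.
From mathcomp Require Import complex ring lra.
From mathcomp Require Import all_classical all_reals all_analysis.
Import Order.TTheory GRing.Theory Num.Theory.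
Import numFieldNormedType.Exports.
Local Open Scope classical_set_scope.
Local Open Scope ring_scope.
Local Open Scope complex_scope.

Set Implicit Arguments.
Unset Strict Implicit.
Unset Printing Implicit Defensive.
Import ComplexField.Normc.

(** * The modulus and the topology of the complex plane *)

(** Without Cauchy's formula, complex differentiability of h and g says nothing about continuity or
    differentiability of h' and g'. Both are recovered from f: h' = f_z and g' is the conjugate of
    f_zbar, so h' and g' are real differentiable because f is C^2. Having complex primitives, they
    then satisfy the Cauchy-Riemann equation, and this is what yields Taylor expansions of order 2.
    These expansions are available for h and g but not for h' and g' themselves, whence the detour
    through difference quotients in the Schwarz-Pick lemma.

    The same shortage shapes the Schwarz lemma: dividing by x costs one order at 0, so the usual
    quotient is replaced by one that vanishes there. *)

Section Modulus.
Variable R : realType.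
Local Notation C := (cplx R).
Implicit Types (z w : R[i]) (r : R).

Lemma normc_sqrtE z : normc z = Num.sqrt (complex.Re z ^+ 2 + complex.Im z ^+ 2).
Proof. by case: z. Qed.

Lemma normc_sqrE z : normc z ^+ 2 = complex.Re z ^+ 2 + complex.Im z ^+ 2.
Proof. by rewrite normc_sqrtE sqr_sqrtr // addr_ge0 // sqr_ge0. Qed.

Lemma normc_ge0 z : 0 <= normc z.
Proof. by rewrite normc_sqrtE sqrtr_ge0. Qed.

Lemma normc_eq0 z : (normc z == 0) = (z == 0).
Proof.
apply/eqP/eqP => [/eq0_normc//|->].
exact: normc0.
Qed.

Lemma normc_gt0 z : (0 < normc z) = (z != 0).
Proof. by rewrite lt_neqAle normc_ge0 andbT eq_sym normc_eq0. Qed.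

Lemma normc_real r : normc r%:C = `|r|.
Proof. by rewrite normc_sqrtE /= expr0n addr0 sqrtr_sqr. Qed.

Lemma normc_conj z : normc (conjc z) = normc z.
Proof. by rewrite !normc_sqrtE; case: z => a b /=; rewrite sqrrN. Qed.

Lemma normc_i : normc ('i%C : R[i]) = 1.
Proof. by rewrite normc_sqrtE /= expr0n add0r expr1n sqrtr1. Qed.

Lemma normcX z n : normc (z ^+ n) = normc z ^+ n.
Proof.
elim: n => [|n IH]; first by rewrite !expr0 normc1.
by rewrite !exprS normcM IH.
Qed.

Lemma normc_div z w : normc (z / w) = normc z / normc w.
Proof. by rewrite normcM normcV. Qed.

Lemma distcC z w : normc (z - w) = normc (w - z).
Proof. by rewrite -normcN opprB. Qed.

Lemma le_normcB z w : normc (z - w) <= normc z + normc w.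
Proof. by rewrite -[normc w]normcN le_normcD. Qed.

Lemma le_normc_subl z w : normc z - normc w <= normc (z - w).
Proof. by rewrite lerBlDr -{1}(subrK w z) le_normcD. Qed.

Lemma le_normc_addl z w : normc z - normc w <= normc (z + w).
Proof. by have := le_normc_subl z (- w); rewrite opprK normcN. Qed.

Lemma normRe_le z : `|complex.Re z| <= normc z.
Proof. by rewrite normc_sqrtE -sqrtr_sqr ler_wsqrtr // lerDl sqr_ge0. Qed.

Lemma normIm_le z : `|complex.Im z| <= normc z.
Proof. by rewrite normc_sqrtE -sqrtr_sqr ler_wsqrtr // lerDr sqr_ge0. Qed.

Lemma Re_le z : complex.Re z <= normc z.
Proof. exact: le_trans (ler_norm _) (normRe_le z). Qed.

Lemma normc_le_ReIm z : normc z <= `|complex.Re z| + `|complex.Im z|.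
Proof.
rewrite -(@ler_pXn2r _ 2) ?nnegrE ?addr_ge0 ?normc_ge0 //.
rewrite normc_sqrE -(real_normK (num_real (complex.Re z))).
rewrite -(real_normK (num_real (complex.Im z))).
have := normr_ge0 (complex.Re z); have := normr_ge0 (complex.Im z); nra.
Qed.

Lemma normcCE (z : C) : `|z| = (normc z)%:C.
Proof. by rewrite normc_sqrtE; exact: normc_def. Qed.

Lemma diskP (w z : C) r : disk w r z <-> normc (z - w) < r.
Proof.
rewrite /disk -ball_normE /ball_ /= normcCE ltcR distcC.
by [].
Qed.

Lemma unit_diskP (z : C) : unit_disk z <-> normc z < 1.
Proof. by rewrite /unit_disk diskP subr0. Qed.

(** The balls of [cplx R] have radii in R[i]; positive elements of R[i] being real, neighbourhoods
    can be described with real radii. *)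
Lemma gt0_cplx (e : R[i]) : 0 < e -> exists2 r : R, 0 < r & e = r%:C.
Proof. by case: e => a b; rewrite ltcE /= => /andP[/eqP -> a0]; exists a. Qed.

Lemma nbhs_cplxP (z : C) (A : set C) :
  nbhs z A <-> exists2 d : R, 0 < d & forall x, normc (x - z) < d -> A x.
Proof.
rewrite -(@nbhs_ballE _ C); split=> [[e /= /gt0_cplx[r r0 ->] sub]|[d d0 sub]].
  by exists r => // x xz; apply: sub; apply/diskP.
exists d%:C => /=; first by rewrite ltcR.
by move=> x /diskP; exact: sub.
Qed.

Lemma nbhs_realP (z : R) (A : set R) :
  nbhs z A <-> exists2 d : R, 0 < d & forall x, `|x - z| < d -> A x.
Proof.
rewrite -(@nbhs_ballE _ R); split=> [[e /= e0 sub]|[d d0 sub]].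
  by exists e => // x xz; apply: sub; rewrite /ball /= distrC.
by exists d => // x; rewrite /ball /= distrC; exact: sub.
Qed.

Lemma continuous_cplxP (f : C -> C) (z : C) : {for z, continuous f} <->
  forall e : R, 0 < e -> exists2 d : R, 0 < d &
    forall x, normc (x - z) < d -> normc (f x - f z) < e.
Proof.
split=> [cf e e0|cf].
  have /cf/nbhs_cplxP[d d0 sub] : nbhs (f z) [set y | normc (y - f z) < e].
    by apply/nbhs_cplxP; exists e.
  by exists d => // x /sub.
move=> A /nbhs_cplxP[e e0 sub]; apply/nbhs_cplxP.
by have [d d0 h] := cf e e0; exists d => // x /h /sub.
Qed.

Lemma continuous_cplx_realP (f : C -> R) (z : C) : {for z, continuous f} <->
  forall e : R, 0 < e -> exists2 d : R, 0 < d &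
    forall x, normc (x - z) < d -> `|f x - f z| < e.
Proof.
split=> [cf e e0|cf].
  have /cf/nbhs_cplxP[d d0 sub] : nbhs (f z) [set y | `|y - f z| < e].
    by apply/nbhs_realP; exists e.
  by exists d => // x /sub.
move=> A /nbhs_realP[e e0 sub]; apply/nbhs_cplxP.
by have [d d0 h] := cf e e0; exists d => // x /h /sub.
Qed.

Lemma continuous_real_cplxP (f : R -> C) (z : R) : {for z, continuous f} <->
  forall e : R, 0 < e -> exists2 d : R, 0 < d &
    forall x, `|x - z| < d -> normc (f x - f z) < e.
Proof.
split=> [cf e e0|cf].
  have /cf/nbhs_realP[d d0 sub] : nbhs (f z) [set y | normc (y - f z) < e].
    by apply/nbhs_cplxP; exists e.
  by exists d => // x /sub.
move=> A /nbhs_cplxP[e e0 sub]; apply/nbhs_realP.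
by have [d d0 h] := cf e e0; exists d => // x /h /sub.
Qed.

Lemma continuous_Re (z : C) : {for z, continuous (@complex.Re R : C -> R)}.
Proof.
apply/continuous_cplx_realP => e e0; exists e => // x xz.
by apply: le_lt_trans xz; rewrite -raddfB; exact: (normRe_le (x - z)).
Qed.

Lemma continuous_Im (z : C) : {for z, continuous (@complex.Im R : C -> R)}.
Proof.
apply/continuous_cplx_realP => e e0; exists e => // x xz.
by apply: le_lt_trans xz; rewrite -raddfB; exact: (normIm_le (x - z)).
Qed.

End Modulus.

(** * Complex differentiability and Taylor expansions *)

Section TaylorCalculus.
Variable R : realType.
Local Notation C := (cplx R).
Implicit Types (f g s : C -> C) (z : C).

(* R[i] carries several convertible topologies; the epsilon-delta form of
   continuity does not depend on which one is inferred. *)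
Definition cont_at (f : C -> C) (z : C) : Prop :=
  forall e : R, 0 < e -> exists2 d : R, 0 < d &
    forall x, normc (x - z) < d -> normc (f x - f z) < e.

Lemma cont_atP f z : {for z, continuous f} <-> cont_at f z.
Proof. exact: continuous_cplxP. Qed.

Lemma cont_atD f g z : cont_at f z -> cont_at g z ->
  cont_at (fun x => f x + g x) z.
Proof.
move=> /cont_atP cf /cont_atP cg; apply/cont_atP.
exact: (@continuousD _ C C f g z cf cg).
Qed.

Lemma cont_atM f g z : cont_at f z -> cont_at g z ->
  cont_at (fun x => f x * g x) z.
Proof.
move=> /cont_atP cf /cont_atP cg; apply/cont_atP.
exact: (@continuousM C C f g z cf cg).
Qed.

Lemma cont_atV f z : f z != 0 -> cont_at f z -> cont_at (fun x => (f x)^-1) z.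
Proof.
move=> fz0 /cont_atP cf; apply/cont_atP.
exact: (@continuousV C C f z fz0 cf).
Qed.

Lemma cont_at_cst (c : C) z : cont_at (fun=> c) z.
Proof. by move=> e e0; exists 1 => // x _; rewrite subrr normc0. Qed.

Lemma cont_at_id z : cont_at (fun x => x) z.
Proof. by move=> e e0; exists e. Qed.

Lemma cont_at_comp f g z : cont_at g z -> cont_at f (g z) ->
  cont_at (fun x => f (g x)) z.
Proof.
move=> cg cf e /cf[d d0 fd]; have [d' d'0 gd] := cg d d0.
by exists d' => // x /gd/fd.
Qed.

Lemma near_cplxP (z : C) (P : C -> Prop) :
  (\forall x \near z, P x) <->
  exists2 d : R, 0 < d & forall x, normc (x - z) < d -> P x.
Proof. exact: nbhs_cplxP. Qed.

(* Caratheodory's form of differentiability, iterated: being [smooth k] at z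
   amounts to having a Taylor expansion of order k there. *)
Fixpoint smooth (k : nat) (f : C -> C) (z : C) : Prop :=
  if k is k'.+1 then
    exists2 s, smooth k' s z & forall x, f x = f z + (x - z) * s x
  else cont_at f z.

Lemma smooth_near k f g z : (\forall x \near z, f x = g x) ->
  smooth k g z -> smooth k f z.
Proof.
elim: k f g => [|k IH] f g /= fg.
  have fgz : f z = g z by exact: nbhs_singleton fg.
  move=> cg e e0.
  have [d d0 gd] := cg e e0.
  have /near_cplxP[d' d'0 fgd] := fg.
  exists (Num.min d d'); first by rewrite lt_min d0.
  by move=> x; rewrite lt_min => /andP[xd xd']; rewrite fgd // fgz gd.
have fgz : f z = g z by exact: nbhs_singleton fg.
case=> s ss gs.
(* The slope identity must hold for every x, while f and g agree only near z: off z the slope of f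
   is forced to be its difference quotient, and near z this coincides with s. *)
exists (fun x => if x == z then s z else (f x - f z) / (x - z)).
  apply: IH ss; near=> x.
  case: eqP => [->//|/eqP xz].
  have -> : f x = g x by near: x.
  by rewrite fgz gs addrAC subrr add0r mulrAC divff ?subr_eq0 // mul1r.
move=> x; case: eqP => [->|/eqP xz]; first by rewrite subrr mul0r addr0.
by rewrite mulrC divfK ?subr_eq0 // addrC subrK.
Unshelve. all: by end_near. Qed.

Lemma smoothS_near k f s z : smooth k s z ->
  (\forall x \near z, f x = f z + (x - z) * s x) -> smooth k.+1 f z.
Proof.
move=> ss fs; apply: (smooth_near (g := fun x => f z + (x - z) * s x)) => //.
by exists s => // x; rewrite subrr mul0r addr0.
Qed.

Lemma smoothW k f z : smooth k.+1 f z -> smooth k f z.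
Proof.
elim: k f => [|k IH] f /= [s ss fs]; last by exists s => //; apply: IH.
have -> : f = fun x => f z + (x - z) * s x by apply/funext.
apply: cont_atD; first exact: cont_at_cst.
apply: cont_atM => //; apply: cont_atD; [exact: cont_at_id|exact: cont_at_cst].
Qed.

Lemma smooth_cont k f z : smooth k f z -> cont_at f z.
Proof. by elim: k => // k IH /smoothW. Qed.

Lemma smooth_cst k c z : smooth k (fun=> c) z.
Proof.
elim: k c => [|k IH] c /=; first exact: cont_at_cst.
by exists (fun=> 0) => [|x]; [exact: IH|rewrite mulr0 addr0].
Qed.

Lemma smooth_id k z : smooth k (fun x => x) z.
Proof.
case: k => [|k]; first exact: cont_at_id.
exists (fun=> 1); first exact: smooth_cst.
by move=> x; rewrite mulr1 addrC subrK.
Qed.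

Lemma smoothD k f g z : smooth k f z -> smooth k g z ->
  smooth k (fun x => f x + g x) z.
Proof.
elim: k f g => [|k IH] f g /=; first exact: cont_atD.
move=> [s ss fs] [t st gt]; exists (fun x => s x + t x); first exact: IH.
by move=> x; rewrite fs gt; ring.
Qed.

Lemma smoothM k f g z : smooth k f z -> smooth k g z ->
  smooth k (fun x => f x * g x) z.
Proof.
elim: k f g => [|k IH] f g; first exact: cont_atM.
move=> [s ss fs] hg; have gW := smoothW hg; case: hg => t st gt.
exists (fun x => s x * g x + f z * t x).
  by apply: smoothD; apply: IH => //; exact: smooth_cst.
by move=> x; rewrite fs [in LHS]gt [in RHS](gt x); ring.
Qed.

Lemma smoothZ k c f z : smooth k f z -> smooth k (fun x => c * f x) z.
Proof. by apply: smoothM; exact: smooth_cst. Qed.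

Lemma smoothN k f z : smooth k f z -> smooth k (fun x => - f x) z.
Proof.
move=> sf; have -> : (fun x => - f x) = (fun x => -1 * f x).
  by apply/funext => x; rewrite mulN1r.
exact: smoothZ.
Qed.

Lemma smoothB k f g z : smooth k f z -> smooth k g z ->
  smooth k (fun x => f x - g x) z.
Proof. by move=> sf sg; apply: smoothD => //; exact: smoothN. Qed.

Lemma smoothX k n f z : smooth k f z -> smooth k (fun x => f x ^+ n) z.
Proof.
move=> sf; elim: n => [|n IH]; first exact: smooth_cst.
have -> : (fun x => f x ^+ n.+1) = (fun x => f x * f x ^+ n).
  by apply/funext => x; rewrite exprS.
exact: smoothM.
Qed.

Lemma smooth_comp k f g z : smooth k g z -> smooth k f (g z) ->
  smooth k (fun x => f (g x)) z.
Proof.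
elim: k f g => [|k IH] f g; first exact: cont_at_comp.
move=> hg; have gW := smoothW hg; case: hg => t st gt [s ss fs].
exists (fun x => t x * s (g x)); first by apply: smoothM => //; exact: IH.
move=> x; rewrite fs; have -> : g x - g z = (x - z) * t x by rewrite (gt x); ring.
by rewrite mulrA.
Qed.

Lemma smoothV k f z : f z != 0 -> smooth k f z -> smooth k (fun x => (f x)^-1) z.
Proof.
move=> fz0; elim: k f fz0 => [|k IH] f fz0; first exact: cont_atV.
move=> hf; have cf := smooth_cont hf; have fW := smoothW hf.
case: hf => s ss fs.
(* From 1 / f x - 1 / f z = - (f x - f z) / (f z * f x), which is valid only where f x is nonzero,
   hence near z. *)
apply: (smoothS_near (s := fun x => - (f z)^-1 * (s x * (f x)^-1))).
  by apply: smoothZ; apply: smoothM => //; exact: IH.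
have /near_cplxP[d d0 fd] : \forall x \near z, f x != 0.
  move: cf => /(_ (normc (f z))); rewrite normc_gt0 => /(_ fz0).
  case=> d d0 fd; apply/near_cplxP; exists d => // x /fd.
  by apply: contraTneq => ->; rewrite sub0r normcN ltxx.
apply/near_cplxP; exists d => // x /fd fx0.
have -> : (x - z) * (- (f z)^-1 * (s x * (f x)^-1)) =
  ((x - z) * s x) * (- (f z)^-1 * (f x)^-1) by ring.
have -> : (x - z) * s x = f x - f z by rewrite fs addrAC subrr add0r.
by field; rewrite fx0.
Qed.

Definition cderiv (f : C -> C) (z d : C) : Prop :=
  exists s, [/\ cont_at s z, s z = d
              & forall x, f x = f z + (x - z) * s x].

Lemma cderiv_smooth f z d : cderiv f z d -> smooth 1 f z.
Proof. by case=> s [cs _ fs]; exists s. Qed.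

Lemma cderiv_cont f z d : cderiv f z d -> cont_at f z.
Proof. by move/cderiv_smooth/smooth_cont. Qed.

Lemma cderivD f g z a b : cderiv f z a -> cderiv g z b ->
  cderiv (fun x => f x + g x) z (a + b).
Proof.
move=> [s [cs sz fs]] [t [ct tz gt]]; exists (fun x => s x + t x); split.
- exact: cont_atD.
- by rewrite sz tz.
- by move=> x; rewrite fs gt; ring.
Qed.

Lemma cderivZ c f z a : cderiv f z a -> cderiv (fun x => c * f x) z (c * a).
Proof.
move=> [s [cs sz fs]]; exists (fun x => c * s x); split.
- by apply: cont_atM => //; exact: cont_at_cst.
- by rewrite sz.
- by move=> x; rewrite fs; ring.
Qed.

Lemma cderiv_comp f g z a b : cderiv g z b -> cderiv f (g z) a ->
  cderiv (fun x => f (g x)) z (a * b).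
Proof.
move=> hg [s [cs sz fs]]; have cg := cderiv_cont hg.
case: hg => t [ct tz gt]; exists (fun x => s (g x) * t x); split.
- by apply: cont_atM => //; exact: cont_at_comp.
- by rewrite sz tz.
- move=> x; rewrite fs; have -> : g x - g z = (x - z) * t x.
    by rewrite (gt x); ring.
  by ring.
Qed.

Lemma cderiv_near f z (d : C) : (forall e : R, 0 < e -> exists2 r : R, 0 < r &
    forall x : C, normc (x - z) < r ->
      normc (f x - f z - (x - z) * d) <= e * normc (x - z)) ->
  cderiv f z d.
Proof.
move=> h; exists (fun x => if x == z then d else (f x - f z) / (x - z)); split.
- move=> e e0; have [r r0 hr] := h (e / 2) (divr_gt0 e0 (ltr0Sn _ _)).
  exists r => // x xz; rewrite eqxx; case: eqP => [_|/eqP xz0].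
    by rewrite subrr normc0.
  have -> : (f x - f z) / (x - z) - d = (f x - f z - (x - z) * d) / (x - z).
    by field; rewrite subr_eq0.
  have n0 : 0 < normc (x - z) by rewrite normc_gt0 subr_eq0.
  rewrite normc_div ltr_pdivrMr //; apply: le_lt_trans (hr _ xz) _.
  by rewrite ltr_pM2r // ltr_pdivrMr // ltr_pMr // ltr1n.
- by rewrite eqxx.
- move=> x; case: eqP => [->|/eqP xz]; first by rewrite subrr mul0r addr0.
  by rewrite mulrC divfK ?subr_eq0 // addrC subrK.
Qed.

Lemma derivable_cderiv f z : derivable f z 1 -> cderiv f z ('D_1 f z).
Proof.
move=> df; apply: cderiv_near => e e0.
have nb : nbhs ('D_1 f z : C) [set y | normc (y - 'D_1 f z) < e].
  by apply/nbhs_cplxP; exists e.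
have /nbhs_cplxP[r r0 hr] := df _ nb.
exists r => // x xz; have [->|xz0] := eqVneq x z.
  by rewrite !subrr mul0r subrr normc0 mulr0.
have xzn0 : x - z != 0 by rewrite subr_eq0.
have := hr (x - z); rewrite subr0 => /(_ xz xzn0) /=.
have -> : (x - z) *: (1 : C) + z = x by rewrite /GRing.scale /= mulr1 subrK.
set d : C := 'D_1 f z.
have -> : (x - z)^-1 *: (f x - f z) - d = (f x - f z - (x - z) * d) / (x - z).
  by rewrite /GRing.scale /=; field.
rewrite normc_div ltr_pdivrMr ?normc_gt0 //.
exact: ltW.
Qed.

End TaylorCalculus.

(** * The mean value inequality for complex-valued curves *)

Section MeanValue.
Variable R : realType.
Local Notation C := (cplx R).

Lemma caratheodory_is_derive (u s : R -> R) (x : R) :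
  (forall e, 0 < e -> exists2 d, 0 < d &
     forall y, `|y - x| < d -> `|s y - s x| < e) ->
  (\forall y \near x, u y = u x + (y - x) * s y) ->
  is_derive x 1 u (s x).
Proof.
move=> cs us.
have lim : (fun h : R => h^-1 *: ((u \o shift x) (h *: 1) - u x)) @ 0^' --> s x.
  move=> A /nbhs_realP[e e0 sub].
  have [d d0 hd] := cs e e0.
  have /nbhs_realP[d' d'0 hd'] := us.
  apply/nbhs_realP; exists (Num.min d d'); first by rewrite lt_min d0.
  move=> h; rewrite subr0 lt_min => /andP[hd1 hd2] h0 /=; apply: sub.
  have -> : h *: 1 + x = x + h by rewrite /GRing.scale /= mulr1 addrC.
  have e1 : x + h - x = h by rewrite addrAC subrr add0r.
  rewrite hd' ?e1 // [u x + _]addrC addrK /GRing.scale /= mulKf //.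
  by apply: hd; rewrite e1.
apply: DeriveDef; first by apply/cvg_ex; exists (s x).
exact: cvg_lim lim.
Qed.

Definition rderiv (g : R -> C) (x : R) (d : C) : Prop :=
  exists s : R -> C, [/\ forall e, 0 < e -> exists2 r : R, 0 < r &
       forall y, `|y - x| < r -> normc (s y - s x) < e,
     s x = d & forall y, g y = g x + (y - x)%:C * s y].

Lemma rderivD g h x a b : rderiv g x a -> rderiv h x b ->
  rderiv (fun y => g y + h y) x (a + b).
Proof.
move=> [s [cs sx gs]] [t [ct tx ht]]; exists (fun y => s y + t y); split.
- move=> e e0; have e2 : 0 < e / 2 by rewrite divr_gt0.
  have [r r0 hr] := cs _ e2; have [r' r'0 hr'] := ct _ e2.
  exists (Num.min r r'); first by rewrite lt_min r0.
  move=> y; rewrite lt_min => /andP[/hr y1 /hr' y2].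
  have -> : s y + t y - (s x + t x) = (s y - s x) + (t y - t x) by ring.
  by apply: le_lt_trans (le_normcD _ _) _; rewrite (splitr e) ltrD.
- by rewrite sx tx.
- by move=> y; rewrite gs ht; ring.
Qed.

Lemma rderivZ c g x a : rderiv g x a -> rderiv (fun y => c * g y) x (c * a).
Proof.
move=> [s [cs sx gs]]; exists (fun y => c * s y); split.
- move=> e e0; have c0 : 0 < normc c + 1 by rewrite ltr_wpDl ?normc_ge0.
  have [r r0 hr] := cs _ (divr_gt0 e0 c0).
  exists r => // y /hr; rewrite ltr_pdivlMr // => h.
  rewrite -mulrBr normcM; apply: le_lt_trans h.
  by rewrite mulrC ler_wpM2l ?normc_ge0 // lerDl.
- by rewrite sx.
- by move=> y; rewrite gs; ring.
Qed.

Lemma rderiv_conj g x a : rderiv g x a ->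
  rderiv (fun y => conjc (g y)) x (conjc a).
Proof.
move=> [s [cs sx gs]]; exists (fun y => conjc (s y)); split.
- move=> e /cs[r r0 hr]; exists r => // y /hr.
  by rewrite -rmorphB normc_conj.
- by rewrite sx.
- move=> y; rewrite gs rmorphD rmorphM /=; congr (_ + _ * _).
  exact: conjc_real.
Qed.

(** These are the comparison curves: linear ones (b = 0) for [harmonic_mean_value], quadratic ones
    for [primitive_increment]. *)
Lemma rderiv_poly2 (a b : C) x :
  rderiv (fun y => y%:C * a + (y ^+ 2)%:C * b) x (a + (2 * x)%:C * b).
Proof.
exists (fun y => a + (y + x)%:C * b); split.
- move=> e e0; have b0 : 0 < normc b + 1 by rewrite ltr_wpDl ?normc_ge0.
  exists (e / (normc b + 1)); first by rewrite divr_gt0.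
  move=> y; rewrite ltr_pdivlMr // => h.
  have -> : a + (y + x)%:C * b - (a + (x + x)%:C * b) = (y - x)%:C * b.
    by rewrite !rmorphD rmorphN; ring.
  rewrite normcM normc_real; apply: le_lt_trans h.
  by rewrite ler_wpM2l ?normr_ge0 // lerDl.
- by rewrite mulrDl !mul1r.
- by move=> y; rewrite rmorphB !rmorphXn rmorphD /=; ring.
Qed.

Lemma cderiv_segment f (z w d : C) (x : R) : cderiv f (z + x%:C * w) d ->
  rderiv (fun y => f (z + y%:C * w)) x (d * w).
Proof.
move=> [s [cs sd fs]]; exists (fun y => s (z + y%:C * w) * w); split.
- move=> e e0; have w0 : 0 < normc w + 1 by rewrite ltr_wpDl ?normc_ge0.
  have [r r0 hr] := cs _ (divr_gt0 e0 w0).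
  exists (r / (normc w + 1)); first by rewrite divr_gt0.
  move=> y; rewrite ltr_pdivlMr // => h.
  rewrite -mulrBl normcM.
  have /hr : normc (z + y%:C * w - (z + x%:C * w)) < r.
    have -> : z + y%:C * w - (z + x%:C * w) = (y - x)%:C * w.
      by rewrite rmorphB; ring.
    rewrite normcM normc_real; apply: le_lt_trans h.
    by rewrite ler_wpM2l ?normr_ge0 // lerDl.
  rewrite ltr_pdivlMr // => h'; apply: le_lt_trans h'.
  by rewrite ler_wpM2l ?normc_ge0 // lerDl.
- by rewrite sd.
- by move=> y; rewrite fs rmorphB; ring.
Qed.

Lemma rderiv_is_derive g x a c : rderiv g x a ->
  is_derive x 1 (fun y => complex.Re (c * g y)) (complex.Re (c * a)).
Proof.
move=> /(rderivZ c)[s [cs sx gs]]; rewrite -sx.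
apply: (caratheodory_is_derive (s := fun y => complex.Re (s y))).
  move=> e /cs[r r0 hr]; exists r => // y /hr; apply: le_lt_trans.
  by rewrite -raddfB; exact: (normRe_le (s y - s x)).
near=> y; rewrite gs; case: (c * g x) (s y) => [u v] [u' v'] /=.
by rewrite mul0r subr0.
Unshelve. all: by end_near. Qed.

Lemma mul_conjc (z : R[i]) : z * conjc z = (normc z ^+ 2)%:C.
Proof.
rewrite normc_sqrE; case: z => a b /=; apply/eqP; rewrite eq_complex /=.
by apply/andP; split; apply/eqP; ring.
Qed.

Lemma is_derive_increment (u du : R -> R) (a b : R) : a < b ->
  (forall x, a <= x <= b -> is_derive x 1 u (du x)) ->
  exists2 x, a <= x <= b & u b - u a = du x * (b - a).
Proof.
move=> ab dudu.
have [x||x xab ->] := @MVT_segment R u du a b (ltW ab).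
- by rewrite in_itv /= => /andP[? ?]; apply: dudu; rewrite !ltW.
- apply: derivable_within_continuous => x; rewrite in_itv /= => /dudu.
  by case.
- by exists x; first by move: xab; rewrite in_itv.
Qed.

(** Projecting on the direction of g 1 - g 0 reduces the claim to the real mean value theorem for B
    - Re (c g), whose derivative is nonnegative. *)
Lemma mean_value_ineq (g d : R -> C) (B B' : R -> R) :
  (forall x : R, 0 <= x <= 1 -> rderiv g x (d x)) ->
  (forall x : R, 0 <= x <= 1 -> is_derive x 1 B (B' x)) ->
  (forall x : R, 0 <= x <= 1 -> normc (d x) <= B' x) ->
  normc (g 1 - g 0) <= B 1 - B 0.
Proof.
move=> dg dB gB; set v := g 1 - g 0.
(* If v = 0 then c = 0, as division by 0 gives 0; in all cases |c| <= 1 and c v = |v|. *)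
pose c : C := conjc v / (normc v)%:C.
pose u x : R := B x - complex.Re (c * g x).
have du (x : R) : 0 <= x <= 1 -> is_derive x 1 u (B' x - complex.Re (c * d x)).
  by move=> x01; apply: is_deriveB; [exact: dB|exact/rderiv_is_derive/dg].
have c1 : normc c <= 1.
  rewrite /c normc_div normc_conj normc_real ger0_norm ?normc_ge0 //.
  have [->|v0] := eqVneq (normc v) 0; first by rewrite mul0r.
  by rewrite divff.
have cv : complex.Re (c * g 1) - complex.Re (c * g 0) = normc v.
  rewrite -raddfB -mulrBr -/v /c.
  have [->|v0] := eqVneq v 0; first by rewrite mulr0 normc0.
  have -> : conjc v / (normc v)%:C * v = (normc v)%:C => [|//].
  rewrite mulrAC [_ * v]mulrC mul_conjc expr2 rmorphM /= mulfK //.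
  by rewrite eq_complex /= eqxx andbT normc_eq0.
have [x x01 ux] := is_derive_increment ltr01 du.
have : 0 <= u 1 - u 0.
  rewrite ux subr0 mulr1 subr_ge0; apply: le_trans (gB _ x01).
  apply: le_trans (Re_le _) _; rewrite normcM.
  by rewrite ler_piMl ?normc_ge0.
rewrite /u -cv; lra.
Qed.

(** The bound B' may vary along the segment: a constant one gives [harmonic_lipschitz], one with a
    logarithmic primitive gives [landau_growth]. *)
Lemma harmonic_mean_value (H G H1 G1 : C -> C) (a b z w : C) (B B' : R -> R) :
  (forall x : R, 0 <= x <= 1 -> cderiv H (z + x%:C * w) (H1 (z + x%:C * w))) ->
  (forall x : R, 0 <= x <= 1 -> cderiv G (z + x%:C * w) (G1 (z + x%:C * w))) ->
  (forall x : R, 0 <= x <= 1 -> is_derive x 1 B (B' x)) ->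
  (forall x : R, 0 <= x <= 1 -> normc w *
     (normc (H1 (z + x%:C * w) - a) + normc (G1 (z + x%:C * w) - b)) <= B' x) ->
  normc (H (z + w) + conjc (G (z + w)) - (H z + conjc (G z))
         - (a * w + conjc (b * w))) <= B 1 - B 0.
Proof.
move=> dH dG dB le_B.
pose g (x : R) : C := H (z + x%:C * w) + conjc (G (z + x%:C * w)) +
  -1 * ((x%:C * (a * w + conjc (b * w)) + (x ^+ 2)%:C * 0) : C).
have -> : H (z + w) + conjc (G (z + w)) - (H z + conjc (G z))
  - (a * w + conjc (b * w)) = g 1 - g 0.
  by rewrite /g mul1r mul0r addr0; ring.
apply: (mean_value_ineq (d := fun x => H1 (z + x%:C * w) * w +
  conjc (G1 (z + x%:C * w) * w) +
  -1 * ((a * w + conjc (b * w)) + (2 * x)%:C * 0)) (B' := B')) => // x x01.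
- apply: rderivD; last exact/rderivZ/rderiv_poly2.
  by apply: rderivD; [|apply: rderiv_conj]; apply: cderiv_segment; auto.
- apply: le_trans (le_B _ x01).
  set h := H1 _; set k := G1 _.
  have -> : h * w + conjc (k * w) + -1 * (a * w + conjc (b * w) + (2 * x)%:C * 0)
      = (h - a) * w + conjc ((k - b) * w).
    by rewrite [(k - b) * w]mulrBl rmorphB; ring.
  apply: le_trans (le_normcD _ _) _.
  by rewrite normc_conj !normcM -mulrDl mulrC.
Qed.

Lemma is_derive_linear (M x : R) : is_derive x 1 (fun y : R => y * M) M.
Proof.
apply: (caratheodory_is_derive (s := fun=> M)) => [e e0|].
  by exists 1 => // y _; rewrite subrr normr0.
by near=> y; ring.
Unshelve. all: by end_near. Qed.

Lemma harmonic_lipschitz (H G H1 G1 : C -> C) (a b z w : C) (M : R) :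
  (forall x : R, 0 <= x <= 1 -> cderiv H (z + x%:C * w) (H1 (z + x%:C * w))) ->
  (forall x : R, 0 <= x <= 1 -> cderiv G (z + x%:C * w) (G1 (z + x%:C * w))) ->
  (forall x : R, 0 <= x <= 1 ->
     normc (H1 (z + x%:C * w) - a) + normc (G1 (z + x%:C * w) - b) <= M) ->
  normc (H (z + w) + conjc (G (z + w)) - (H z + conjc (G z))
         - (a * w + conjc (b * w))) <= M * normc w.
Proof.
move=> dH dG le_M.
have -> : M * normc w = 1 * (normc w * M) - 0 * (normc w * M) by ring.
apply: (harmonic_mean_value dH dG (B := fun y => y * (normc w * M))
  (B' := fun=> normc w * M)) => x x01; first exact: is_derive_linear.
by rewrite ler_wpM2l ?normc_ge0 ?le_M.
Qed.

Lemma holomorphic_lipschitz (f f1 : C -> C) (a z w : C) (M : R) :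
  (forall x : R, 0 <= x <= 1 -> cderiv f (z + x%:C * w) (f1 (z + x%:C * w))) ->
  (forall x : R, 0 <= x <= 1 -> normc (f1 (z + x%:C * w) - a) <= M) ->
  normc (f (z + w) - f z - a * w) <= M * normc w.
Proof.
move=> df le_M.
have := @harmonic_lipschitz f (fun=> 0) f1 (fun=> 0) a 0 z w M df.
rewrite rmorph0 !mul0r conjc0 !addr0; apply.
- move=> x _; exists (fun=> 0); split => //; first exact: cont_at_cst.
  by move=> y; rewrite mulr0 addr0.
- by move=> x x01; rewrite subrr normc0 addr0 le_M.
Qed.

End MeanValue.

(** * Real differentiability of C^1 maps, and Cauchy-Riemann for functions with a primitive *)

Section RealDifferentiability.
Variable R : realType.
Local Notation C := (cplx R).

Lemma is_derive_increment_abs (u du : R -> R) (a h : R) :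
  (forall x : R, `|x - a| <= `|h| -> is_derive x 1 u (du x)) ->
  exists2 x : R, `|x - a| <= `|h| & u (a + h) - u a = du x * h.
Proof.
move=> dudu; have [h0|h0|->] := ltgtP h 0; last first.
- by exists a; rewrite ?addr0 ?subrr ?normr0 ?mulr0.
- have [||x xab ux] := @is_derive_increment R u du a (a + h).
  + by lra.
  + by move=> x xab; apply: dudu; rewrite [`|h|]gtr0_norm // ger0_norm; lra.
  + exists x; first by rewrite [`|h|]gtr0_norm // ger0_norm; lra.
    by rewrite ux addrAC subrr add0r.
- have [||x xab ux] := @is_derive_increment R u du (a + h) a.
  + by lra.
  + by move=> x xab; apply: dudu; rewrite [`|h|]ltr0_norm // ler0_norm; lra.
  + exists x; first by rewrite [`|h|]ltr0_norm // ler0_norm; lra.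
    by rewrite -opprB ux; ring.
Qed.

Lemma partials_differentiable (u : C -> R) (z : C) (r : R) : 0 < r ->
  (forall x : C, normc (x - z) < r ->
     derivable (line_x u x) (complex.Re x) 1 /\
     derivable (line_y u x) (complex.Im x) 1) ->
  {for z, continuous (part_x u)} -> {for z, continuous (part_y u)} ->
  forall e : R, 0 < e -> exists2 d : R, 0 < d & forall w : C, normc w < d ->
    `|u (z + w) - u z - (part_x u z * complex.Re w + part_y u z * complex.Im w)|
      <= e * normc w.
Proof.
move=> r0 du /continuous_cplx_realP cx /continuous_cplx_realP cy e e0.
have e2 : 0 < e / 2 by rewrite divr_gt0.
have [dx dx0 hx] := cx _ e2; have [dy dy0 hy] := cy _ e2.
(* Both legs of the path below stay within |a| + |b| <= 2 |w| of z. *)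
exists (Num.min r (Num.min dx dy) / 2).
  by rewrite divr_gt0 // !lt_min r0 dx0.
case=> a b; set w := (X in normc X < _ -> _) => wd.
case: z {cx cy} du hx hy => x0 y0 du hx hy.
have na : `|a| <= normc w by exact: (normRe_le w).
have nb : `|b| <= normc w by exact: (normIm_le w).
have close (v : C) : normc v <= `|a| + `|b| ->
    [/\ normc v < r, normc v < dx & normc v < dy].
  move=> va; have vw : normc v < Num.min r (Num.min dx dy).
    apply: le_lt_trans va _; move: wd na nb; set m := Num.min _ _; lra.
  by move: vw; rewrite !lt_min => /andP[-> /andP[-> ->]].
have nc (p q : R) : `|p| <= `|a| -> `|q| <= `|b| -> normc (p +i* q) <= `|a| + `|b|.
  by move=> pa qb; apply: le_trans (normc_le_ReIm _) _; exact: lerD.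
(* The path goes horizontally from z to (x0 + a, y0), then vertically to z + w, with one mean value
   theorem on each leg. *)
have [x xa ux] : exists2 x : R, `|x - x0| <= `|a| &
    u ((x0 + a) +i* y0) - u (x0 +i* y0) = part_x u (x +i* y0) * a.
  apply: (@is_derive_increment_abs (fun s => u (s +i* y0))
    (fun s => part_x u (s +i* y0))).
  move=> s sa; have /close[sr _ _] : normc ((s +i* y0) - (x0 +i* y0) : C) <= `|a| + `|b|.
    by rewrite /= subrr nc ?normr0.
  have [dsx _] := du _ sr; rewrite /part_x derive1E; exact: derivableP.
have [y yb uy] : exists2 y : R, `|y - y0| <= `|b| &
    u ((x0 + a) +i* (y0 + b)) - u ((x0 + a) +i* y0) = part_y u ((x0 + a) +i* y) * b.
  apply: (@is_derive_increment_abs (fun s => u ((x0 + a) +i* s))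
    (fun s => part_y u ((x0 + a) +i* s))).
  move=> s sb.
  have /close[sr _ _] : normc (((x0 + a) +i* s) - (x0 +i* y0) : C) <= `|a| + `|b|.
    by rewrite /= [x0 + a]addrC addrK nc.
  have [_ dsy] := du _ sr; rewrite /part_y derive1E; exact: derivableP.
have /close[_ /hx hx' _] : normc ((x +i* y0) - (x0 +i* y0) : C) <= `|a| + `|b|.
  by rewrite /= subrr nc ?normr0.
have /close[_ _ /hy hy'] : normc (((x0 + a) +i* y) - (x0 +i* y0) : C) <= `|a| + `|b|.
  by rewrite /= [x0 + a]addrC addrK nc.
have -> : u ((x0 +i* y0) + w) - u (x0 +i* y0) -
    (part_x u (x0 +i* y0) * complex.Re w + part_y u (x0 +i* y0) * complex.Im w) =
  (part_x u (x +i* y0) - part_x u (x0 +i* y0)) * a +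
  (part_y u ((x0 + a) +i* y) - part_y u (x0 +i* y0)) * b.
  rewrite !mulrBl -ux -uy /w /=; ring.
apply: le_trans (ler_normD _ _) _; rewrite !normrM.
rewrite (splitr e) mulrDl lerD // ler_pM ?normr_ge0 // ltW //.
Qed.

(** Real differentiability in Wirtinger form: A and B are the values of f_z and f_zbar at z. *)
Definition rdiff (f : C -> C) (z A B : C) : Prop :=
  forall e : R, 0 < e -> exists2 d : R, 0 < d & forall w : C, normc w < d ->
    normc (f (z + w) - f z - (A * w + B * conjc w)) <= e * normc w.

Lemma rdiffD f g z A B A' B' : rdiff f z A B -> rdiff g z A' B' ->
  rdiff (fun x => f x + g x) z (A + A') (B + B').
Proof.
move=> df dg e e0; have e2 : 0 < e / 2 by rewrite divr_gt0.
have [d d0 hd] := df _ e2; have [d' d'0 hd'] := dg _ e2.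
exists (Num.min d d'); first by rewrite lt_min d0.
move=> w; rewrite lt_min => /andP[/hd fw /hd' gw].
have -> : f (z + w) + g (z + w) - (f z + g z) -
    ((A + A') * w + (B + B') * conjc w) =
  (f (z + w) - f z - (A * w + B * conjc w)) +
  (g (z + w) - g z - (A' * w + B' * conjc w)) by ring.
by apply: le_trans (le_normcD _ _) _; rewrite (splitr e) mulrDl lerD.
Qed.

Lemma rdiffZ c f z A B : rdiff f z A B ->
  rdiff (fun x => c * f x) z (c * A) (c * B).
Proof.
move=> df e e0; have c0 : 0 < normc c + 1 by rewrite ltr_wpDl ?normc_ge0.
have [d d0 hd] := df _ (divr_gt0 e0 c0); exists d => // w /hd fw.
have -> : c * f (z + w) - c * f z - (c * A * w + c * B * conjc w) =
  c * (f (z + w) - f z - (A * w + B * conjc w)) by ring.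
rewrite normcM; apply: le_trans (ler_wpM2l (normc_ge0 _) fw) _.
rewrite mulrA ler_wpM2r ?normc_ge0 // mulrCA ger_pMr // ler_pdivrMr // mul1r.
by rewrite lerDl.
Qed.

Lemma rdiff_conj f z A B : rdiff f z A B ->
  rdiff (fun x => conjc (f x)) z (conjc B) (conjc A).
Proof.
move=> df e /df[d d0 hd]; exists d => // w /hd.
rewrite -normc_conj !(rmorphB, rmorphD, rmorphM) /= conjcK.
by rewrite [_ * w + _]addrC.
Qed.

Lemma rdiff_near f g z A B : (\forall x \near z, f x = g x) ->
  rdiff g z A B -> rdiff f z A B.
Proof.
move=> fg; have fgz := nbhs_singleton fg.
have /near_cplxP[d d0 hd] := fg.
move=> dg e /dg[d' d'0 hd']; exists (Num.min d d'); first by rewrite lt_min d0.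
move=> w; rewrite lt_min => /andP[wd /hd']; rewrite -fgz -hd //.
by rewrite addrAC subrr add0r.
Qed.

Lemma C1_rdiff (D : set C) (f : C -> C) (z : C) : nbhs z D -> C1_on D f ->
  exists A B, rdiff f z A B.
Proof.
move=> /nbhs_cplxP[r r0 rD] Df.
have zD : D z by apply: rD; rewrite subrr normc0.
have [_ _ cx cy] := Df _ zD.
have cRe (u : C -> C) : {for z, continuous u} ->
    {for z, continuous (fun x => complex.Re (u x))}.
  by move=> cu; exact: (continuous_comp cu (@continuous_Re R (u z))).
have cIm (u : C -> C) : {for z, continuous u} ->
    {for z, continuous (fun x => complex.Im (u x))}.
  by move=> cu; exact: (continuous_comp cu (@continuous_Im R (u z))).
have dRe := @partials_differentiable (re_part f) z r r0 _ (cRe _ cx) (cRe _ cy).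
have dIm := @partials_differentiable (im_part f) z r r0 _ (cIm _ cx) (cIm _ cy).
pose X := cpart_x f z; pose Y := cpart_y f z.
exists (2^-1 * (X - 'i%C * Y)), (2^-1 * (X + 'i%C * Y)) => e e0.
have e2 : 0 < e / 2 by rewrite divr_gt0.
have [|d d0 hd] := dRe _ _ e2; first by move=> x /rD/Df[].
have [|d' d'0 hd'] := dIm _ _ e2; first by move=> x /rD/Df[].
exists (Num.min d d'); first by rewrite lt_min d0.
move=> w; rewrite lt_min => /andP[/hd fw /hd' gw].
rewrite (splitr e) mulrDl; apply: le_trans (lerD fw gw).
apply: le_trans (normc_le_ReIm _) _.
have -> : 2^-1 * (X - 'i%C * Y) * w + 2^-1 * (X + 'i%C * Y) * conjc w =
  (complex.Re w)%:C * X + (complex.Im w)%:C * Y.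
  have -> : 2^-1 * (X - 'i%C * Y) * w + 2^-1 * (X + 'i%C * Y) * conjc w =
     X * ((w + conjc w) / 2) - Y * ('i%C * (w - conjc w) / 2) by field.
  have -> : (w + conjc w) / 2 = (complex.Re w)%:C.
    by rewrite addcJ mulrAC divff // mul1r.
  have -> : 'i%C * (w - conjc w) / 2 = - (complex.Im w)%:C.
    rewrite subcJ; have : 'i%C * 'i%C = -1 :> R[i] by rewrite -expr2 sqr_i.
    set i : R[i] := 'i%C => ii.
    have -> : i * (2 * (complex.Im w)%:C * i) / 2 = (i * i) * (complex.Im w)%:C by field.
    by rewrite ii mulN1r.
  by ring.
rewrite /re_part /im_part.
case: w {fw gw} (f (z + w)) (f z) => a b [p q] [p' q'].
rewrite /X /Y /cpart_x /cpart_y /re_part /im_part /=.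
by rewrite !mul0r !subr0 !addr0 ![a * _]mulrC ![b * _]mulrC.
Qed.

(** The main term is the integral of the affine part of [h1] along the segment from z + w1 to z +
    w2; the mean value inequality stands in for integration. *)
Lemma primitive_increment (h h1 : C -> C) (z A B : C) (r : R) : 0 < r ->
  (forall x : C, normc (x - z) < r -> cderiv h x (h1 x)) -> rdiff h1 z A B ->
  forall e : R, 0 < e -> exists2 d : R, 0 < d & forall w1 w2 : C,
    normc w1 < d -> normc w2 < d ->
    normc (h (z + w2) - h (z + w1) - ((h1 z + A * w1 + B * conjc w1) * (w2 - w1)
      + 2^-1 * (A * (w2 - w1) + B * conjc (w2 - w1)) * (w2 - w1)))
      <= e * (normc w1 + normc w2) * normc (w2 - w1).
Proof.
move=> r0 dh dh1 e e0; have [d d0 hd] := dh1 e e0.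
exists (Num.min r d); first by rewrite lt_min r0.
move=> w1 w2 w1d w2d; set v := w2 - w1.
have segE (x : R) : w1 + x%:C * v = (1 - x)%:C * w1 + x%:C * w2.
  by rewrite rmorphB /v; ring.
have seg (x : R) : 0 <= x <= 1 -> normc (w1 + x%:C * v) <=
    (1 - x) * normc w1 + x * normc w2.
  move=> /andP[x0 x1]; rewrite segE; apply: le_trans (le_normcD _ _) _.
  by rewrite !normcM !normc_real !ger0_norm ?subr_ge0.
have segd (x : R) : 0 <= x <= 1 -> normc (w1 + x%:C * v) < Num.min r d.
  move=> x01; apply: le_lt_trans (seg _ x01) _.
  have Mm : Num.max (normc w1) (normc w2) < Num.min r d by rewrite gt_max w1d.
  apply: le_lt_trans Mm; case/andP: x01 => x0 x1.
  have : normc w1 <= Num.max (normc w1) (normc w2) by rewrite le_max lexx.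
  have : normc w2 <= Num.max (normc w1) (normc w2) by rewrite le_max lexx orbT.
  set M := Num.max _ _; nra.
have segs (x : R) : 0 <= x <= 1 ->
    normc (w1 + x%:C * v) <= normc w1 + normc w2.
  move=> x01; apply: le_trans (seg _ x01) _; case/andP: x01 => x0 x1.
  by have := normc_ge0 w1; have := normc_ge0 w2; nra.
(* The derivative a + 2 x b of x a + x^2 b is v times the affine part of [h1] at w1 + x v, so the
   derivative of g is v times the error of that affine approximation. *)
pose a : C := (h1 z + A * w1 + B * conjc w1) * v.
pose b : C := 2^-1 * (A * v + B * conjc v) * v.
pose g (x : R) : C := h ((z + w1) + x%:C * v) + -1 * (x%:C * a + (x ^+ 2)%:C * b).
set M := e * _ * _.
have -> : h (z + w2) - h (z + w1) - ((h1 z + A * w1 + B * conjc w1) * v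
      + 2^-1 * (A * v + B * conjc v) * v) = g 1 - g 0.
  have z1 : z + w1 + (1 : R)%:C * v = z + w2 by rewrite /v; ring.
  have z0 : z + w1 + (0 : R)%:C * v = z + w1 by ring.
  rewrite /g z1 z0 -/a -/b expr1n expr0n /=; ring.
have -> : M = 1 * M - 0 * M by ring.
apply: (mean_value_ineq (B := fun x => x * M) (B' := fun=> M)
  (d := fun x => h1 ((z + w1) + x%:C * v) * v + -1 * (a + (2 * x)%:C * b))).
- move=> x x01; apply: rderivD; last exact/rderivZ/rderiv_poly2.
  apply: cderiv_segment; apply: dh.
  have -> : z + w1 + x%:C * v - z = w1 + x%:C * v by ring.
  by have := segd _ x01; rewrite lt_min => /andP[].
- by move=> x _; exact: is_derive_linear.
- move=> x x01.
  have xE : conjc (x%:C : R[i]) = x%:C by exact: conjc_real.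
  have -> : h1 (z + w1 + x%:C * v) * v + -1 * (a + (2 * x)%:C * b) =
     (h1 (z + (w1 + x%:C * v)) - h1 z - (A * (w1 + x%:C * v) +
       B * conjc (w1 + x%:C * v))) * v.
    have -> : conjc (w1 + x%:C * v) = conjc w1 + x%:C * conjc v.
      by rewrite rmorphD rmorphM /= -[in RHS]xE.
    have -> : (2 * x)%:C = 2 * x%:C :> R[i] by rewrite rmorphM rmorph_nat.
    by rewrite /a /b -addrA; field.
  rewrite normcM ler_wpM2r ?normc_ge0 //.
  apply: le_trans (hd _ _) _.
    by have := segd _ x01; rewrite lt_min => /andP[].
  by rewrite ler_wpM2l ?(ltW e0) ?segs.
Qed.

(* A real-differentiable function with a complex primitive satisfies the
   Cauchy-Riemann equation: compare the increments of the primitive along the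
   three sides of the triangle z, z + d, z + id. *)
Lemma primitive_cauchy_riemann (h h1 : C -> C) (z A B : C) (r : R) : 0 < r ->
  (forall x : C, normc (x - z) < r -> cderiv h x (h1 x)) -> rdiff h1 z A B ->
  B = 0.
Proof.
move=> r0 dh dh1; apply/eqP; rewrite -normc_eq0 eq_le normc_ge0 andbT.
apply/ler_addgt0Pr => e e0; rewrite add0r.
(* With |w1| = |w2| = s and |w2 - w1| <= 2 s, the errors on the three sides are at most 1, 1 and 4
   times s^2 e / 6. *)
have e6 : 0 < e / 6 by rewrite divr_gt0.
have [d d0 hd] := primitive_increment r0 dh dh1 e6.
pose s := d / 2; have s0 : 0 < s by rewrite divr_gt0.
have sd : s < d by rewrite /s; lra.
pose w1 : C := s%:C; pose w2 : C := 'i%C * s%:C.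
have n1 : normc w1 = s by rewrite normc_real ger0_norm ?ltW.
have n2 : normc w2 = s by rewrite normcM normc_i mul1r normc_real ger0_norm ?ltW.
have n21 : normc (w2 - w1) <= s + s by rewrite -{1}n2 -n1 le_normcB.
have := hd 0 w1; have := hd 0 w2; have := hd w1 w2.
rewrite normc0 n1 n2 !subr0 !addr0 !add0r conjc0 !mulr0 !addr0 n1 n2.
move=> /(_ sd sd) h12 /(_ d0 sd) h02 /(_ d0 sd) h01.
have c1 : conjc w1 = w1 by exact: conjc_real.
have ii : 'i%C * 'i%C = -1 :> R[i] by rewrite -expr2 sqr_i.
have ci : conjc ('i%C : R[i]) = - 'i%C by apply/eqP; rewrite eq_complex /= oppr0 !eqxx.
have w21 : w2 = 'i%C * w1 by [].
have c2 : conjc w2 = - 'i%C * w1 by rewrite w21 rmorphM; congr (_ * _).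
have c21 : conjc (w2 - w1) = - 'i%C * w1 - w1.
  by rewrite rmorphB; congr (_ - _).
move: h12 h02 h01; rewrite c21 c1 c2 w21.
set i : R[i] := 'i%C in ii *.
set E12 := (X in normc X <= _ -> _); set E02 := (X in _ -> normc X <= _ -> _).
set E01 := (X in _ -> _ -> normc X <= _ -> _) => h12 h02 h01.
(* Around the closed triangle the increments of h and the complex-affine terms cancel; what is left
   is B times the integral of conj w, which is 2 i times the area, that is i s^2. *)
have BE : B * (i * w1 * w1) = E02 - E01 - E12.
  rewrite /E02 /E01 /E12.
  have i2 : i ^+ 2 = -1 by rewrite expr2.
  by field: i2.
have : normc B * s ^+ 2 <= e * s ^+ 2.
  have -> : normc B * s ^+ 2 = normc (E02 - E01 - E12).
    by rewrite -BE !normcM normc_i mul1r n1 expr2.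
  apply: le_trans (le_normcB _ _) _; apply: le_trans (lerD (le_normcB _ _) (lexx _)) _.
  apply: le_trans (lerD (lerD h02 h01) h12) _.
  have : e / 6 * (s + s) * normc (w2 - w1) <= e / 6 * (s + s) * (s + s).
    by rewrite ler_wpM2l // mulr_ge0 ?ltW // addr_gt0.
  rewrite w21 => le4.
  by apply: le_trans (lerD (lexx _) le4) _; rewrite expr2; lra.
by rewrite ler_pM2r // exprn_gt0.
Qed.

(** Once B = 0, [primitive_increment] with w1 = 0 is a Taylor expansion of order 2, with second
    coefficient A / 2. *)
Lemma primitive_smooth (h h1 : C -> C) (z A B : C) (r : R) : 0 < r ->
  (forall x : C, normc (x - z) < r -> cderiv h x (h1 x)) -> rdiff h1 z A B ->
  smooth 2 h z.
Proof.
move=> r0 dh dh1; have B0 := primitive_cauchy_riemann r0 dh dh1.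
have inc := primitive_increment r0 dh dh1.
pose b x := if x == z then 2^-1 * A
  else (h x - h z - h1 z * (x - z)) / (x - z) ^+ 2.
exists (fun x => h1 z + (x - z) * b x); last first.
  move=> x; rewrite /b; case: eqP => [->|/eqP xz].
    by rewrite subrr !mul0r addr0.
  by field; rewrite subr_eq0.
exists b; last by move=> x; rewrite subrr mul0r addr0.
move=> e e0; have e2 : 0 < e / 2 by rewrite divr_gt0.
have [d d0 hd] := inc _ e2.
exists d => // x xd; rewrite /b eqxx; case: eqP => [_|/eqP xz].
  by rewrite subrr normc0.
have n0 : 0 < normc (x - z) by rewrite normc_gt0 subr_eq0.
have xzn : x - z != 0 by rewrite subr_eq0.
have -> : (h x - h z - h1 z * (x - z)) / (x - z) ^+ 2 - 2^-1 * A =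
  (h x - h z - (h1 z * (x - z) + 2^-1 * (A * (x - z)) * (x - z))) / (x - z) ^+ 2.
  by field.
rewrite normc_div normcX ltr_pdivrMr ?exprn_gt0 //.
have := hd 0 (x - z); rewrite normc0 B0 => /(_ d0 xd).
have -> : z + (x - z) = x by ring.
rewrite !subr0 !addr0 !mulr0 !mul0r !addr0 add0r => H.
apply: le_lt_trans H _.
rewrite -mulrA -expr2 ltr_pM2r ?exprn_gt0 //; lra.
Qed.

End RealDifferentiability.

(** * Maximum modulus principle and the Schwarz-Pick lemma *)

Section MaximumModulus.
Variable R : realType.
Local Notation C := (cplx R).

Definition rcont_at (u : C -> R) (z : C) : Prop :=
  forall e : R, 0 < e -> exists2 d : R, 0 < d &
    forall x, normc (x - z) < d -> `|u x - u z| < e.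

Lemma rcont_atP u z : {for z, continuous u} <-> rcont_at u z.
Proof. exact: continuous_cplx_realP. Qed.

Lemma rcont_atD u v z : rcont_at u z -> rcont_at v z ->
  rcont_at (fun x => u x + v x) z.
Proof.
move=> /rcont_atP cu /rcont_atP cv; apply/rcont_atP.
exact: (@continuousD _ R C u v z cu cv).
Qed.

Lemma rcont_atM u v z : rcont_at u z -> rcont_at v z ->
  rcont_at (fun x => u x * v x) z.
Proof.
move=> /rcont_atP cu /rcont_atP cv; apply/rcont_atP.
exact: (@continuousM R C u v z cu cv).
Qed.

Lemma rcont_at_cst (a : R) z : rcont_at (fun=> a) z.
Proof. by move=> e e0; exists 1 => // x _; rewrite subrr normr0. Qed.

Lemma rcont_atN u z : rcont_at u z -> rcont_at (fun x => - u x) z.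
Proof.
by move=> cu e /cu[d d0 hd]; exists d => // x /hd; rewrite -opprD normrN.
Qed.

Lemma rcont_atB u v z : rcont_at u z -> rcont_at v z ->
  rcont_at (fun x => u x - v x) z.
Proof. by move=> cu cv; apply: rcont_atD => //; exact: rcont_atN. Qed.

Lemma rcont_atX u n z : rcont_at u z -> rcont_at (fun x => u x ^+ n) z.
Proof.
move=> cu; elim: n => [|n IH]; first exact: rcont_at_cst.
have -> : (fun x => u x ^+ n.+1) = (fun x => u x * u x ^+ n).
  by apply/funext => x; rewrite exprS.
exact: rcont_atM.
Qed.

Lemma rcont_at_normc (f : C -> C) z : cont_at f z ->
  rcont_at (fun x => normc (f x)) z.
Proof.
move=> cf e /cf[d d0 hd]; exists d => // x /hd; apply: le_lt_trans.
rewrite ler_norml le_normc_subl andbT.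
by rewrite lerNl opprB distcC le_normc_subl.
Qed.

Lemma rcont_at_Re z : rcont_at (@complex.Re R) z.
Proof. by apply/rcont_atP; exact: continuous_Re. Qed.

Lemma rcont_at_comp u f z : cont_at f z -> rcont_at u (f z) ->
  rcont_at (fun x => u (f x)) z.
Proof.
move=> cf cu e /cu[d d0 ud]; have [d' d'0 fd] := cf d d0.
by exists d' => // x /fd/ud.
Qed.

Definition closed_disk (c : C) (r : R) : set C := [set x | normc (x - c) <= r].

Lemma closed_disk_compact (c : C) (r : R) : compact (closed_disk c r).
Proof.
pose g (p : R * R) : C := c + (p.1 +i* p.2).
have cg : continuous g.
  move=> p A /nbhs_cplxP[e e0 sub].
  rewrite -nbhs_ballE; exists (e / 2); first by rewrite /= divr_gt0.
  move=> q [/= q1 q2]; apply: sub.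
  have -> : g q - g p = (q.1 - p.1) +i* (q.2 - p.2).
    by rewrite /g opprD addrACA subrr add0r.
  apply: le_lt_trans (normc_le_ReIm _) _ => /=.
  move: q1 q2; rewrite /ball /= ![`|p.1 - _|]distrC ![`|p.2 - _|]distrC; lra.
have cK : compact (g @` (`[- r, r] `*` `[- r, r])).
  apply: continuous_compact; first exact: continuous_subspaceT.
  by apply: compact_setX; exact: segment_compact.
apply: subclosed_compact cK _.
  rewrite -[closed_disk c r]setCK; apply: open_closedC.
  rewrite openE => x /= /negP; rewrite -ltNge => rx.
  apply/nbhs_cplxP; exists (normc (x - c) - r); first by rewrite subr_gt0.
  move=> y xy /=; apply/negP; rewrite -ltNge.
  have : normc (x - c) <= normc (y - c) + normc (y - x).
    have -> : x - c = (y - c) - (y - x) by ring.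
    exact: le_normcB.
  by move: xy; lra.
move=> x; rewrite /closed_disk /= => xr.
exists (complex.Re (x - c), complex.Im (x - c)) => /=.
  split => /=; rewrite in_itv /= -ler_norml; apply: le_trans xr.
    exact: (normRe_le (x - c)).
  exact: (normIm_le (x - c)).
rewrite /g /=; have -> : complex.Re (x - c) +i* complex.Im (x - c) = x - c.
  by case: (x - c).
by rewrite addrC subrK.
Qed.

Lemma rcont_max (u : C -> R) (c : C) (r : R) : 0 <= r ->
  (forall x, normc (x - c) <= r -> rcont_at u x) ->
  exists2 z, normc (z - c) <= r & forall x, normc (x - c) <= r -> u x <= u z.
Proof.
move=> r0 cu.
have [||z zr zmax] := compact_EVT_max _ (@closed_disk_compact c r) (f := u).
- by exists c; rewrite /closed_disk /= subrr normc0.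
- apply: continuous_in_subspaceT => x; rewrite inE => xr.
  by apply/rcont_atP; exact: cu.
exists z; first by rewrite inE in zr.
by move=> x xr; apply: zmax; rewrite inE.
Qed.

Lemma rcont_min (u : C -> R) (c : C) (r : R) : 0 <= r ->
  (forall x, normc (x - c) <= r -> rcont_at u x) ->
  exists2 z, normc (z - c) <= r & forall x, normc (x - c) <= r -> u z <= u x.
Proof.
move=> r0 cu.
have [|z zr zmax] := @rcont_max (fun x => - u x) c r r0.
  by move=> x /cu; exact: rcont_atN.
by exists z => // x /zmax; rewrite lerN2.
Qed.

Lemma normcD_sqr (q d : R[i]) :
  normc (q + d) ^+ 2 = normc q ^+ 2 + 2 * complex.Re (conjc q * d) + normc d ^+ 2.
Proof. rewrite !normc_sqrE; case: q d => a b [a' b'] /=; ring. Qed.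

Lemma ReD (x y : R[i]) : complex.Re (x + y) = complex.Re x + complex.Re y.
Proof. by case: x y => a b []. Qed.

(* The mean of |Q|^2 + e |z|^2 over the four points z + i^k t exceeds the value
   at z by e t^2 + o(t^2), the terms of order 1 and 2 of Q averaging to 0. *)
Lemma no_interior_max (Q : C -> C) (z : C) (e r : R) : 0 < e -> 0 < r ->
  smooth 2 Q z ->
  exists2 x : C, normc (x - z) <= r &
    normc (Q z) ^+ 2 + e * normc z ^+ 2 < normc (Q x) ^+ 2 + e * normc x ^+ 2.
Proof.
move=> e0 r0 [s [b cb sb] Qs].
apply: contrapT => noex.
have le_max (x : C) : normc (x - z) <= r ->
    normc (Q x) ^+ 2 + e * normc x ^+ 2 <= normc (Q z) ^+ 2 + e * normc z ^+ 2.
  by move=> xr; rewrite leNgt; apply/negP => lt_x; apply: noex; exists x.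
set q := Q z in Qs le_max *.
have q1 : 0 < normc q + 1 by rewrite ltr_wpDl ?normc_ge0.
(* The four remainders, each below eta |q| t^2 when q is nonzero, must stay under the gain 2 e t^2;
   the + 1 covers q = 0. *)
pose eta := e / (2 * (normc q + 1)).
have eta0 : 0 < eta by rewrite divr_gt0 // mulr_gt0.
have [d d0 hd] := cb eta eta0.
pose t := Num.min r (d / 2).
have t0 : 0 < t by rewrite lt_min r0 divr_gt0.
have td : t < d by rewrite /t gt_min; apply/orP; right; lra.
have tr : t <= r by rewrite /t ge_min lexx.
pose B w : C := b (z + w * t%:C).
have nt (w : C) : normc w = 1 -> normc (z + w * t%:C - z) = t.
  move=> w1; have -> : z + w * t%:C - z = w * t%:C by ring.
  by rewrite normcM w1 mul1r normc_real gtr0_norm.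
pose E w : C := conjc q * (w * (t%:C * s z) + w ^+ 2 * t%:C ^+ 2 * B w).
pose F w : C := conjc z * (w * t%:C).
have point (w : C) : normc w = 1 ->
    complex.Re (E w) + e * complex.Re (F w) + e * t ^+ 2 / 2 <= 0.
  move=> w1; have := le_max (z + w * t%:C); rewrite nt // => /(_ tr).
  have -> : Q (z + w * t%:C) = q + (w * (t%:C * s z) + w ^+ 2 * t%:C ^+ 2 * B w).
    by rewrite Qs sb /B -/q; ring.
  rewrite normcD_sqr [normc (z + _) ^+ 2]normcD_sqr -/(E w) -/(F w).
  have -> : normc (w * t%:C) ^+ 2 = t ^+ 2.
    by rewrite normcM w1 mul1r normc_real gtr0_norm.
  have := sqr_ge0 (normc (w * (t%:C * s z) + w ^+ 2 * t%:C ^+ 2 * B w)).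
  set X := normc _ ^+ 2; set Y := normc _ ^+ 2; set Z := complex.Re _.
  set W := complex.Re _; set V := normc _ ^+ 2; nra.
have ii : 'i%C ^+ 2 = -1 :> R[i] by rewrite sqr_i.
have i1 : normc ('i%C : C) = 1 by exact: normc_i.
have p0 := point 1 (normc1 _).
have p1 := point 'i%C i1.
have p2 := point (-1) (etrans (normcN _) (normc1 _)).
have p3 := point (- 'i%C) (etrans (normcN _) i1).
have Bsmall (w : C) : normc w = 1 -> normc (B w - b z) < eta.
  by move=> w1; apply: hd; rewrite nt.
(* The signs are those of w^2 at w = 1, i, -1, -i; they add up to 0, so subtracting [b z] everywhere
   changes nothing and leaves small terms only. *)
pose S := (B 1 - b z) - (B 'i%C - b z) + ((B (-1) - b z) - (B (- 'i%C) - b z)).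
have S4 : normc S < 4 * eta.
  apply: le_lt_trans (le_normcD _ _) _.
  apply: le_lt_trans (lerD (le_normcB _ _) (le_normcB _ _)) _.
  have := Bsmall 1 (normc1 _); have := Bsmall 'i%C i1.
  have := Bsmall (-1) (etrans (normcN _) (normc1 _)).
  have := Bsmall (- 'i%C) (etrans (normcN _) i1); lra.
have sum4 : complex.Re (conjc q * (t%:C ^+ 2 * S)) + 2 * e * t ^+ 2 <= 0.
  have := lerD (lerD p0 p1) (lerD p2 p3); rewrite !addr0; apply: le_trans.
  have EE : complex.Re (E 1) + complex.Re (E 'i%C) +
      (complex.Re (E (-1)) + complex.Re (E (- 'i%C))) =
      complex.Re (conjc q * (t%:C ^+ 2 * S)).
    rewrite -!ReD; congr (complex.Re _); rewrite /E /S.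
    move: (B 1) (B (-1)) (B 'i%C) (B (- 'i%C)) (s z) (b z) (conjc q).
    move=> B1 B2 B3 B4 s0 b0 q0.
    by move: ii; set i : R[i] := 'i%C => ii; ring: ii.
  have FF : complex.Re (F 1) + complex.Re (F 'i%C) +
      (complex.Re (F (-1)) + complex.Re (F (- 'i%C))) = 0.
    rewrite -!ReD (_ : _ + _ = 0) //; rewrite /F; ring.
  have -> : complex.Re (E 1) + e * complex.Re (F 1) + e * t ^+ 2 / 2 +
    (complex.Re (E 'i%C) + e * complex.Re (F 'i%C) + e * t ^+ 2 / 2) +
    (complex.Re (E (-1)) + e * complex.Re (F (-1)) + e * t ^+ 2 / 2 +
    (complex.Re (E (- 'i%C)) + e * complex.Re (F (- 'i%C)) + e * t ^+ 2 / 2)) =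
    (complex.Re (E 1) + complex.Re (E 'i%C) +
      (complex.Re (E (-1)) + complex.Re (E (- 'i%C)))) +
    e * (complex.Re (F 1) + complex.Re (F 'i%C) +
      (complex.Re (F (-1)) + complex.Re (F (- 'i%C)))) +
    2 * e * t ^+ 2 by field.
  by rewrite EE FF mulr0 addr0.
have : - (normc q * (t ^+ 2 * normc S)) <= complex.Re (conjc q * (t%:C ^+ 2 * S)).
  rewrite lerNl; apply: le_trans (ler_norm _) _; rewrite normrN.
  apply: le_trans (normRe_le _) _.
  by rewrite normcM normc_conj normcM normcX normc_real gtr0_norm.
have qS : normc q * normc S < 2 * e.
  apply: (@le_lt_trans _ _ (normc q * (4 * eta))).
    by rewrite ler_wpM2l ?normc_ge0 // ltW.
  have -> : normc q * (4 * eta) = 2 * e * (normc q / (normc q + 1)).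
    by rewrite /eta; field; rewrite gt_eqF.
  rewrite gtr_pMr ?mulr_gt0 // ltr_pdivrMr // mul1r.
  by rewrite ltrDl.
have t2 : 0 < t ^+ 2 by rewrite exprn_gt0.
move: sum4; set Y := complex.Re _; nra.
Qed.

(** The term e' |z|^2 excludes an interior maximum and costs at most e. Smoothness is asked only off
    the zeros of Q, since a maximum point where Q vanishes is harmless; [schwarz_closed] uses a
    quotient known to be merely continuous at 0. *)
Lemma maximum_modulus (Q : C -> C) (r M : R) : 0 <= r -> 0 <= M ->
  (forall z, normc z <= r -> cont_at Q z) ->
  (forall z, normc z < r -> Q z != 0 -> smooth 2 Q z) ->
  (forall z, normc z = r -> normc (Q z) <= M) ->
  forall z, normc z <= r -> normc (Q z) <= M.
Proof.
move=> r0 M0 cQ sQ bQ z zr.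
rewrite -(@ler_pXn2r _ 2) ?nnegrE ?normc_ge0 //.
apply/ler_addgt0Pr => e e0.
have e'0 : 0 < e / (r ^+ 2 + 1) by rewrite divr_gt0 // ltr_wpDl ?sqr_ge0.
set e' := e / _ in e'0.
have e'r : e' * r ^+ 2 <= e.
  rewrite /e' mulrAC ler_pdivrMr ?ltr_wpDl ?sqr_ge0 //.
  by rewrite ler_pM2l // lerDl.
have cu x : normc (x - 0) <= r ->
    rcont_at (fun x => normc (Q x) ^+ 2 + e' * normc x ^+ 2) x.
  rewrite subr0 => /cQ cQx; apply: rcont_atD.
    exact/rcont_atX/rcont_at_normc.
  apply: rcont_atM; first exact: rcont_at_cst.
  exact/rcont_atX/rcont_at_normc/cont_at_id.
have [y yr ymax] := rcont_max r0 cu.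
rewrite subr0 in yr; have {}ymax x : normc x <= r ->
    normc (Q x) ^+ 2 + e' * normc x ^+ 2 <= normc (Q y) ^+ 2 + e' * normc y ^+ 2.
  by move=> xr; apply: ymax; rewrite subr0.
have e'y : e' * normc y ^+ 2 <= e.
  apply: le_trans e'r; rewrite ler_pM2l // ler_pXn2r ?nnegrE ?normc_ge0 //.
have Qz : normc (Q z) ^+ 2 <= normc (Q y) ^+ 2 + e.
  have := ymax z zr; have : 0 <= e' * normc z ^+ 2 by rewrite mulr_ge0 ?sqr_ge0 ?ltW.
  by move: e'y; lra.
apply: le_trans Qz _; rewrite lerD2r ler_pXn2r ?nnegrE ?normc_ge0 //.
move: yr; rewrite le_eqVlt => /orP[/eqP/bQ//|yr].
have [->|Qy0] := eqVneq (Q y) 0; first by rewrite normc0.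
have ry : 0 < r - normc y by rewrite subr_gt0.
have [x xy] := no_interior_max e'0 ry (sQ _ yr Qy0).
rewrite ltNge ymax //.
have -> : x = (x - y) + y by rewrite subrK.
by apply: le_trans (le_normcD _ _) _; rewrite -lerBrDr.
Qed.

End MaximumModulus.

(** * The Schwarz lemma and the Schwarz-Pick inequality for derivatives *)

Section SchwarzPick.
Variable R : realType.
Local Notation C := (cplx R).

Lemma exprn_bounded_le1 (x M : R) : 0 <= x -> (forall n, x ^+ n <= M) -> x <= 1.
Proof.
move=> x0 bx; rewrite leNgt; apply/negP => x1.
have h0 : 0 < x - 1 by rewrite subr_gt0.
have bern n : 1 + n%:R * (x - 1) <= x ^+ n.
  elim: n => [|n IH]; first by rewrite mul0r addr0 expr0.
  rewrite exprS; apply: (@le_trans _ _ (x * (1 + n%:R * (x - 1)))).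
    rewrite -natr1; have : 0 <= n%:R * (x - 1) * (x - 1).
      by rewrite !mulr_ge0 ?(ltW h0).
    by set k := n%:R; nra.
  by rewrite ler_wpM2l.
have M0 : 0 <= M by apply: le_trans (bx 0); rewrite expr0.
have := archi_boundP (divr_ge0 M0 (ltW h0)); set n := Num.bound _.
rewrite ltr_pdivrMr // => Mn.
have := bern n; have := bx n; lra.
Qed.

(** The classical quotient psi x / x inherits only an expansion of order 1 at 0. Instead psi^(n+1) /
    x^n vanishes at 0, where [maximum_modulus] needs continuity alone. It gives |psi z|^(n+1) <=
    (|z| / r)^n for all n, so the powers of |psi z| r / |z| are bounded and [exprn_bounded_le1]
    concludes. *)
Lemma schwarz_closed (psi : C -> C) (r : R) (z : C) : 0 < r ->
  (forall x, normc x <= r -> smooth 2 psi x) -> psi 0 = 0 ->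
  (forall x, normc x <= r -> normc (psi x) <= 1) ->
  normc z <= r -> normc (psi z) * r <= normc z.
Proof.
move=> r0 spsi psi0 bpsi zr.
have [->|z0] := eqVneq z 0; first by rewrite psi0 normc0 mul0r.
have nz : 0 < normc z by rewrite normc_gt0.
have bound n : normc (psi z) ^+ n.+1 <= (normc z / r) ^+ n.
  pose Q (x : C) : C := psi x ^+ n.+1 * (x^-1) ^+ n.
  have M0 : 0 <= (r ^+ n)^-1 by rewrite invr_ge0 exprn_ge0 ?ltW.
  have sQ (x : C) : normc x <= r -> x != 0 -> smooth 2 Q x.
    move=> xr x0; apply: smoothM; first exact/smoothX/spsi.
    by apply/smoothX/smoothV => //; exact: smooth_id.
  have nQ (x : C) : normc (Q x) = normc (psi x) ^+ n.+1 / normc x ^+ n.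
    by rewrite normcM !normcX normcV exprVn.
  have cQ0 : cont_at Q 0.
    have n0 : normc (0 : C) <= r by rewrite normc0 ltW.
    have [s ss sE] := spsi _ n0; have cs := @smooth_cont R 1 s 0 ss.
    have QE : Q = fun x => s x ^+ n * psi x.
      apply/funext => x; rewrite /Q; have [->|x0] := eqVneq x 0.
        by rewrite psi0 mulr0 expr0n mul0r.
      have xn : psi x = x * s x by rewrite sE psi0 subr0 add0r.
      rewrite exprSr mulrAC; congr (_ * _).
      by rewrite xn exprMn mulrC mulrA -exprMn mulVf // expr1n mul1r.
    rewrite QE; apply: (@smooth_cont R 0); apply: smoothM.
      exact: (@smoothX R 0 n s 0 cs).
    exact: smooth_cont (spsi _ n0).
  have := @maximum_modulus R Q r (r ^+ n)^-1 (ltW r0) M0 _ _ _ z zr.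
  rewrite nQ ler_pdivrMr ?exprn_gt0 // expr_div_n mulrC; apply.
  - move=> x xr; have [->//|x0] := eqVneq x 0.
    exact: smooth_cont (sQ _ xr x0).
  - move=> x xr Qx0; apply: sQ; first exact: ltW.
    by apply: contraNneq Qx0 => ->; rewrite /Q psi0 expr0n mul0r.
  - move=> x xr; rewrite nQ xr ler_pdivrMr ?exprn_gt0 // mulVf ?gt_eqF ?exprn_gt0 //.
    by rewrite exprn_ile1 ?normc_ge0 // bpsi // xr.
have [->|p0] := eqVneq (normc (psi z)) 0; first by rewrite mul0r ltW.
have {}p0 : 0 < normc (psi z) by rewrite lt_neqAle eq_sym p0 normc_ge0.
set x := normc z / r in bound; have x0 : 0 < x by rewrite divr_gt0.
rewrite -ler_pdivlMr // -/x -[x]mul1r -ler_pdivrMr //.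
apply: (@exprn_bounded_le1 _ (normc (psi z))^-1); first by rewrite ltW ?divr_gt0.
move=> n; rewrite expr_div_n ler_pdivrMr ?exprn_gt0 // mulrC ler_pdivlMr //.
by rewrite -exprSr.
Qed.

Lemma schwarz (psi : C -> C) (r : R) (z : C) :
  (forall x, normc x < r -> smooth 2 psi x) -> psi 0 = 0 ->
  (forall x, normc x < r -> normc (psi x) <= 1) ->
  normc z < r -> normc (psi z) * r <= normc z.
Proof.
move=> spsi psi0 bpsi zr.
have [->|z0] := eqVneq z 0; first by rewrite psi0 normc0 mul0r.
have nz : 0 < normc z by rewrite normc_gt0.
apply/ler_addgt0Pr => e e0.
pose rho := Num.max (normc z) (r - e).
have rr : rho < r by rewrite /rho gt_max zr /=; lra.
have rz : normc z <= rho by rewrite /rho le_max lexx.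
have re : r - e <= rho by rewrite /rho le_max lexx orbT.
have := @schwarz_closed psi rho z (lt_le_trans nz rz) _ psi0 _ rz.
have b1 := bpsi z zr; have b0 := normc_ge0 (psi z).
move=> H; have : normc (psi z) * rho <= normc z.
  by apply: H => x xr; [apply: spsi|apply: bpsi]; exact: le_lt_trans rr.
by nra.
Qed.

(** For |c| < S it shows that w -> S (w - c) / (S^2 - conj c w) maps the closed disk of radius S
    into the closed unit disk. *)
Lemma pick_identity (S : R) (w c : R[i]) :
  normc (S%:C ^+ 2 - conjc c * w) ^+ 2 - S ^+ 2 * normc (w - c) ^+ 2 =
  (S ^+ 2 - normc c ^+ 2) * (S ^+ 2 - normc w ^+ 2).
Proof. by rewrite !normc_sqrE; case: w c => a b [a' b'] /=; ring. Qed.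

(** [schwarz] applied to phi followed by the automorphism that sends phi 0 to 0; the strict bound at
    0 keeps the denominator away from 0. *)
Lemma schwarz_pick_strict (phi : C -> C) (r S : R) (z : C) :
  (forall x, normc x < r -> smooth 2 phi x) ->
  (forall x, normc x < r -> normc (phi x) <= S) -> normc (phi 0) < S ->
  normc z < r ->
  normc (phi z - phi 0) * (S * r - normc (phi 0) * normc z) <=
    normc z * (S ^+ 2 - normc (phi 0) ^+ 2).
Proof.
move=> sphi bphi cS zr; set c := phi 0 in cS *.
have S0 : 0 < S by exact: le_lt_trans (normc_ge0 _) cS.
have nS : normc (S%:C : C) = S by rewrite normc_real gtr0_norm.
pose den (x : C) : C := S%:C ^+ 2 - conjc c * phi x.
have den_ge x : normc x < r -> S ^+ 2 - normc c * S <= normc (den x).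
  move=> /bphi xS; apply: le_trans (le_normc_subl _ _).
  rewrite normcX nS normcM normc_conj lerD2l lerN2.
  by rewrite ler_wpM2l ?normc_ge0.
have gap : 0 < S ^+ 2 - normc c * S by rewrite expr2 -mulrBl mulr_gt0 // subr_gt0.
have den0 x : normc x < r -> den x != 0.
  by move=> xr; rewrite -normc_gt0; exact: lt_le_trans gap (den_ge _ xr).
pose psi (x : C) : C := S%:C * (phi x - c) * (den x)^-1.
have r0 : 0 < r by exact: le_lt_trans (normc_ge0 _) zr.
have n0r : normc (0 : C) < r by rewrite normc0.
have := @schwarz psi r z _ _ _ zr.
have psi_le1 x : normc x < r -> normc (psi x) <= 1.
  move=> xr; rewrite /psi normc_div ler_pdivrMr ?normc_gt0 ?den0 // mul1r.
  rewrite -(@ler_pXn2r _ 2) ?nnegrE ?normc_ge0 // normcM nS exprMn.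
  have := bphi x xr; have := normc_ge0 (phi x); have := normc_ge0 c.
  rewrite -subr_ge0.
  have -> : normc (den x) ^+ 2 - S ^+ 2 * normc (phi x - c) ^+ 2 =
     (S ^+ 2 - normc c ^+ 2) * (S ^+ 2 - normc (phi x) ^+ 2).
    exact: pick_identity.
  move=> c0 p0 pS; apply: mulr_ge0; nra.
rewrite normc_div => H; have {H} : S * normc (phi z - c) / normc (den z) * r <= normc z.
  have -> : S * normc (phi z - c) = normc (S%:C * (phi z - c)) by rewrite normcM nS.
  apply: H => //; last by rewrite /psi subrr mulr0 mul0r.
  move=> x xr; apply: smoothM.
    by apply: smoothZ; apply: smoothB; [exact: sphi|exact: smooth_cst].
  apply: smoothV; first exact: den0.
  by apply: smoothB; [exact: smooth_cst|exact/smoothZ/sphi].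
rewrite mulrAC ler_pdivrMr ?normc_gt0 ?den0 // => H.
(* Expressing the denominator through phi z - c makes the final inequality linear in |phi z - c|. *)
have denz : normc (den z) <= S ^+ 2 - normc c ^+ 2 + normc c * normc (phi z - c).
  have -> : den z = (S ^+ 2 - normc c ^+ 2)%:C - conjc c * (phi z - c).
    by rewrite rmorphB /= -mul_conjc rmorphXn /den; ring.
  apply: le_trans (le_normcB _ _) _.
  rewrite normcM normc_conj normc_real ger0_norm // subr_ge0.
  by rewrite ler_pXn2r ?nnegrE ?normc_ge0 // ltW.
have := le_trans H (ler_wpM2l (normc_ge0 _) denz); lra.
Qed.

Lemma rcont_at_ge0 (D : C -> R) (r : R) : 0 < r -> rcont_at D 0 ->
  (forall t : R, 0 < t < r -> 0 <= D t%:C) -> 0 <= D 0.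
Proof.
move=> r0 cD D0; rewrite leNgt; apply/negP => Dn.
have Dp : 0 < - D 0 by rewrite oppr_gt0.
have [d d0 hd] := cD _ Dp.
pose t := Num.min d r / 2.
have m0 : 0 < Num.min d r by rewrite lt_min d0.
have t0 : 0 < t by rewrite divr_gt0.
have tm : t < Num.min d r by rewrite /t; lra.
have [td tr] : t < d /\ t < r by move: tm; rewrite lt_min => /andP.
have := hd t%:C; rewrite subr0 normc_real gtr0_norm // => /(_ td).
have := D0 t; rewrite t0 tr => /(_ isT) Dt.
by rewrite ltr_norml => /andP[_]; lra.
Qed.

Lemma schwarz_pick_deriv (p p1 : C -> C) (S : R) (z : C) : 0 < S ->
  (forall x, normc x < 1 -> cderiv p x (p1 x)) ->
  (forall x, normc x < 1 -> smooth 2 p x) ->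
  (forall x, normc x < 1 -> normc (p1 x) <= S) -> normc z < 1 ->
  normc (p1 z - p1 0) * (S - normc (p1 0) * normc z) <=
    normc z * (S ^+ 2 - normc (p1 0) ^+ 2).
Proof.
move=> S0 dp sp bp z1.
have n01 : normc (0 : C) < 1 by rewrite normc0.
have [s [cs sz ps]] := dp z z1; have [s' [cs' s0 ps']] := dp 0 n01.
(* At a real t > 0, D is the slack of [schwarz_pick_strict] for the quotient (p (x + t) - p x) / t
   on the disk of radius 1 - t. The bound is taken to be S + t so as to be strict at 0; the slopes s
   and s' carry D continuously to t = 0. *)
pose D (y : C) : R := normc z * ((S + complex.Re y) ^+ 2 - normc (s' (0 + y)) ^+ 2) -
  normc (s (z + y) - s' (0 + y)) *
  ((S + complex.Re y) * (1 - complex.Re y) - normc (s' (0 + y)) * normc z).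
suff : 0 <= D 0.
  have R0 : complex.Re (0 : C) = 0 by [].
  by rewrite /D R0 !addr0 sz s0 subr0 mulr1 subr_ge0.
have shift (f : C -> C) (x : C) : cont_at f x -> cont_at (fun y => f (x + y)) 0.
  move=> cf; apply: (@cont_at_comp R f (fun y => x + y)); last by rewrite addr0.
  by apply: cont_atD; [exact: cont_at_cst|exact: cont_at_id].
have z1' : 0 < 1 - normc z by rewrite subr_gt0.
apply: (rcont_at_ge0 z1').
  have cRe : rcont_at (fun y : C => S + complex.Re y) 0.
    by apply: rcont_atD; [exact: rcont_at_cst|exact: rcont_at_Re].
  have cs0 : rcont_at (fun y : C => normc (s' (0 + y))) 0.
    exact/rcont_at_normc/shift.
  apply: rcont_atB; apply: rcont_atM.
  - exact: rcont_at_cst.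
  - by apply: rcont_atB; apply: rcont_atX.
  - apply: rcont_at_normc; apply: cont_atD; first exact: shift.
    by apply: (@smoothN R 0); exact: shift.
  - apply: rcont_atB; apply: rcont_atM => //; last exact: rcont_at_cst.
    by apply: rcont_atB; [exact: rcont_at_cst|exact: rcont_at_Re].
move=> t /andP[t0 tz]; rewrite /D /=.
have tC : t%:C != 0 :> C by rewrite eq_complex /= eqxx andbT gt_eqF.
pose phi (x : C) : C := t%:C^-1 * (p (x + t%:C) - p x).
have phiz : phi z = s (z + t%:C).
  by rewrite /phi ps; field.
have phi0 : phi 0 = s' (0 + t%:C).
  by rewrite /phi [p (0 + _)]ps'; field.
rewrite -phiz -phi0.
have nt : normc (t%:C : C) = t by rewrite normc_real gtr0_norm.
have sum1 x : normc x < 1 - t -> normc (x + t%:C) < 1.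
  by move=> xt; apply: le_lt_trans (le_normcD _ _) _; rewrite nt; lra.
have sub1 x : normc x < 1 - t -> normc x < 1 by move=> ?; lra.
have bphi x : normc x < 1 - t -> normc (phi x) <= S.
  move=> xt; rewrite /phi normcM normcV nt mulrC ler_pdivrMr // -[in leRHS]nt.
  have -> : p (x + t%:C) - p x = p (x + t%:C) - p x - 0 * t%:C by ring.
  have seg (y : R) : 0 <= y <= 1 -> normc (x + y%:C * t%:C) < 1.
    move=> /andP[y0 y1]; apply: le_lt_trans (le_normcD _ _) _.
    rewrite normcM nt normc_real ger0_norm //.
    by move: xt; have := normc_ge0 x; nra.
  apply: (holomorphic_lipschitz (f1 := p1)) => y /seg y1; first exact: dp.
  by rewrite subr0 bp.
rewrite subr_ge0; apply: (@schwarz_pick_strict phi (1 - t) (S + t) z).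
- move=> x xt; apply: smoothZ; apply: smoothB; last exact/sp/sub1.
  apply: (@smooth_comp R 2 p (fun x => x + t%:C)); last exact/sp/sum1.
  by apply: smoothD; [exact: smooth_id|exact: smooth_cst].
- by move=> x /bphi; lra.
- have nz := normc_ge0 z; have := bphi 0; rewrite normc0 => b0.
  have : normc (phi 0) <= S by apply: b0; lra.
  by lra.
- by lra.
Qed.

End SchwarzPick.

(** * Perturbations of real-linear maps and univalent disks *)

Section NearlyLinearMaps.
Variable R : realType.
Local Notation C := (cplx R).

(** The real differential of H + conj G at a point where H' = a and G' = b. *)
Definition rlinear (a b x : C) : C := a * x + conjc (b * x).

Lemma rlinearZ a b (t : R) x : rlinear a b (t%:C * x) = t%:C * rlinear a b x.
Proof.
have tE : conjc (t%:C : C) = t%:C by exact: conjc_real.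
rewrite /rlinear; have -> : conjc (b * (t%:C * x)) = t%:C * conjc (b * x).
  by rewrite mulrCA rmorphM; congr (_ * _).
by ring.
Qed.

Lemma rlinear_ge a b x : (normc a - normc b) * normc x <= normc (rlinear a b x).
Proof.
apply: le_trans (le_normc_addl _ _).
by rewrite normc_conj !normcM mulrBl.
Qed.

Lemma rlinear_surj a b v : 0 < normc a - normc b -> exists x, rlinear a b x = v.
Proof.
move=> ab; pose N : C := (normc a ^+ 2 - normc b ^+ 2)%:C.
have N0 : N != 0.
  rewrite eq_complex /= eqxx andbT gt_eqF // subr_gt0.
  by rewrite ltr_pXn2r ?nnegrE ?normc_ge0 // -subr_gt0.
have NE : N = a * conjc a - b * conjc b by rewrite !mul_conjc -rmorphB.
have NJ : conjc N = N by exact: conjc_real.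
(* Cramer's rule for a x + conj b conj x = v and its conjugate; N is the determinant. *)
exists ((conjc a * v - conjc b * conjc v) / N).
rewrite /rlinear; have -> : conjc (b * ((conjc a * v - conjc b * conjc v) / N)) =
    conjc b * ((a * conjc v - b * v) / N).
  by rewrite !(rmorphM, rmorphB, fmorphV) /= !conjcK -[in RHS]NJ.
have -> : a * ((conjc a * v - conjc b * conjc v) / N) +
  conjc b * ((a * conjc v - b * v) / N) = (a * conjc a - b * conjc b) * v / N.
  by ring.
by rewrite -NE mulrAC divff // mul1r.
Qed.

Lemma disk_connected (c : C) (r : R) : connected (disk c r).
Proof.
have [r0|r0] := ltP 0 r; last first.
  suff -> : disk c r = set0 by exact: connected0.
  rewrite -subset0 => x /diskP; rewrite ltNge; move/negP; apply.
  exact: le_trans r0 (normc_ge0 _).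
pose seg (p : C) (s : R) : C := c + s%:C * (p - c).
have -> : disk c r = \bigcup_(p in disk c r) (seg p @` `[0, 1]).
  apply/seteqP; split => [p pr|x [p /diskP pr [s /= s01 <-]]].
    exists p => //; exists 1; first by rewrite /= in_itv /= lexx ler01.
    by rewrite /seg mul1r addrC subrK.
  apply/diskP; move: s01; rewrite in_itv /= => /andP[s0 s1].
  rewrite /seg addrAC subrr add0r normcM normc_real ger0_norm //.
  by apply: le_lt_trans pr; rewrite ler_piMl ?normc_ge0.
apply: bigcup_connected.
  exists c => p _; exists 0; first by rewrite /= in_itv /= lexx ler01.
  by rewrite /seg mul0r addr0.
move=> p _; apply: connected_continuous_connected; first exact: segment_connected.
apply: continuous_subspaceT => s; apply/continuous_real_cplxP => e e0.
have p1 : 0 < normc (p - c) + 1 by rewrite ltr_wpDl ?normc_ge0.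
exists (e / (normc (p - c) + 1)); first by rewrite divr_gt0.
move=> s'; rewrite ltr_pdivlMr // => h.
have -> : seg p s' - seg p s = (s' - s)%:C * (p - c).
  by rewrite /seg rmorphB; ring.
rewrite normcM normc_real; apply: le_lt_trans h.
by rewrite ler_wpM2l ?normr_ge0 // lerDl.
Qed.

Lemma disk_open (c : C) (r : R) : open (disk c r).
Proof.
rewrite openE => x /diskP xr; apply/nbhs_cplxP.
exists (r - normc (x - c)); first by rewrite subr_gt0.
move=> y xy; apply/diskP.
have -> : y - c = (y - x) + (x - c) by ring.
by apply: le_lt_trans (le_normcD _ _) _; rewrite -ltrBrDr.
Qed.

Variables (F : C -> C) (a b : C) (r1 : R).
Let lam := normc a - normc b.
Hypothesis lam0 : 0 < lam.
(** M depends on r and may tend to [lam] as r tends to [r1], as it does in [landau_nearly_linear];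
    hence the arguments below run on disks of radius r < r1. *)
Hypothesis F_lin : forall r : R, 0 <= r < r1 -> exists2 M : R, M < lam &
  forall x y, normc x <= r -> normc y <= r ->
    normc (F y - F x - rlinear a b (y - x)) <= M * normc (y - x).

Lemma nearly_linear_expanding (r : R) : 0 <= r < r1 -> exists2 k : R, 0 < k &
  forall x y, normc x <= r -> normc y <= r ->
    k * normc (y - x) <= normc (F y - F x).
Proof.
move=> /F_lin[M Ml HM]; exists (lam - M); first by rewrite subr_gt0.
move=> x y xr yr; have := HM x y xr yr; have := rlinear_ge a b (y - x).
rewrite -/lam; have := le_normc_subl (rlinear a b (y - x))
  (rlinear a b (y - x) - (F y - F x)).
have -> : rlinear a b (y - x) - (rlinear a b (y - x) - (F y - F x)) = F y - F x by ring.
by rewrite [normc (rlinear a b (y - x) - _)]distcC; lra.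
Qed.

Lemma nearly_linear_injective x y : normc x < r1 -> normc y < r1 ->
  F x = F y -> x = y.
Proof.
move=> xr yr Fxy.
have rr : 0 <= Num.max (normc x) (normc y) < r1.
  by rewrite le_max normc_ge0 gt_max xr.
have [k k0 hk] := nearly_linear_expanding rr.
have := hk x y; rewrite !le_max !lexx orbT Fxy subrr normc0 => /(_ isT isT).
rewrite pmulr_rle0 // => n0; apply/eqP; rewrite eq_sym -subr_eq0 -normc_eq0.
by rewrite eq_le n0 normc_ge0.
Qed.

Lemma nearly_linear_cont x : normc x < r1 -> cont_at F x.
Proof.
move=> xr; have nx := normc_ge0 x.
have rr : 0 <= (normc x + r1) / 2 < r1 by apply/andP; split; lra.
have [M Ml HM] := F_lin rr; move=> e e0.
pose N := `|M| + (normc a + normc b) + 1.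
have N0 : 0 < N by rewrite ltr_wpDl // !addr_ge0 ?normc_ge0.
exists (Num.min (e / N) ((r1 - normc x) / 2)).
  by rewrite lt_min !divr_gt0 // subr_gt0.
move=> y; rewrite lt_min ltr_pdivlMr // => /andP[ye yr].
have yr' : normc y <= (normc x + r1) / 2.
  have -> : y = (y - x) + x by rewrite subrK.
  by apply: le_trans (le_normcD _ _) _; lra.
have xr' : normc x <= (normc x + r1) / 2 by lra.
apply: le_lt_trans ye.
have -> : F y - F x = (F y - F x - rlinear a b (y - x)) + rlinear a b (y - x) by ring.
apply: le_trans (le_normcD _ _) _.
apply: le_trans (lerD (HM x y xr' yr') (le_normcD _ _)) _.
rewrite normc_conj !normcM /N.
have := ler_norm M; have := normc_ge0 (y - x); nra.
Qed.

(* At an interior minimum of |F - w| over a small closed disk a displacement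
   in the direction L^-1 (w - F y) would decrease |F - w|. *)
Lemma nearly_linear_open z (e : R) : normc z < r1 -> 0 < e ->
  exists2 d : R, 0 < d & forall w, normc (w - F z) < d ->
    exists x, [/\ normc (x - z) < e, normc x < r1 & F x = w].
Proof.
move=> zr e0; have nz := normc_ge0 z.
pose r := (normc z + r1) / 2.
have rr : 0 <= r < r1 by apply/andP; split; rewrite /r; lra.
have [k k0 hk] := nearly_linear_expanding rr.
have [M Ml HM] := F_lin rr.
pose e' := Num.min (e / 2) (r - normc z).
have e'0 : 0 < e' by rewrite lt_min divr_gt0 //= /r; lra.
have e'e : e' < e by rewrite /e' gt_min; apply/orP; left; lra.
have e'r : e' <= r - normc z by rewrite /e' ge_min lexx orbT.
have near_r x : normc (x - z) <= e' -> normc x <= r.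
  move=> xz; have -> : x = (x - z) + z by rewrite subrK.
  by apply: le_trans (le_normcD _ _) _; lra.
have rr1 : r < r1 by case/andP: rr.
(* At distance e' from z, |F y - F z| >= k e', so a point w within k e' / 2 of F z is nearer to F z
   than to F y: the minimum cannot lie on the boundary. *)
exists (k * e' / 2); first by rewrite divr_gt0 // mulr_gt0.
move=> w wz.
have [||y yz ymin] := @rcont_min R (fun x => normc (F x - w)) z e'.
- exact: ltW.
- move=> x xz; apply: rcont_at_normc; apply: cont_atD; last exact: cont_at_cst.
  by apply: nearly_linear_cont; apply: le_lt_trans rr1; exact: near_r.
have zz : normc (z - z) <= e' by rewrite subrr normc0 ltW.
have ylt : normc (y - z) < e'.
  rewrite lt_neqAle yz andbT; apply/eqP => yze.
  have := hk z y (near_r _ zz) (near_r _ yz); rewrite yze.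
  have := ymin z zz; rewrite [normc (F z - w)]distcC.
  have := le_normcD (F y - w) (w - F z).
  by rewrite addrA subrK; lra.
exists y; split; [lra|by apply: le_lt_trans rr1; exact: near_r|].
apply/eqP; rewrite -subr_eq0 -normc_eq0; apply/negP => /negP Fyw.
have {}Fyw : 0 < normc (w - F y).
  by rewrite distcC lt_neqAle eq_sym Fyw normc_ge0.
have [v Lv] := rlinear_surj (w - F y) lam0.
have vle : lam * normc v <= normc (w - F y) by rewrite -Lv rlinear_ge.
pose g := e' - normc (y - z); have g0 : 0 < g by rewrite subr_gt0.
have v1 : 0 < normc v + 1 by rewrite ltr_wpDl ?normc_ge0.
(* The bound 1 makes 1 - t nonnegative; the other one keeps y + t v in the closed disk where y is
   minimal. *)
pose t := Num.min 1 (g / (normc v + 1)).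
have t0 : 0 < t by rewrite lt_min ltr01 divr_gt0.
have t1 : t <= 1 by rewrite /t ge_min lexx.
have tg : t * normc v <= g.
  have : t * (normc v + 1) <= g by rewrite -ler_pdivlMr // /t ge_min lexx orbT.
  by have := normc_ge0 v; nra.
pose x := y + t%:C * v.
have xy : x - y = t%:C * v by rewrite /x addrAC subrr add0r.
have nxy : normc (x - y) = t * normc v.
  by rewrite xy normcM normc_real gtr0_norm.
have xz : normc (x - z) <= e'.
  have -> : x - z = (x - y) + (y - z) by ring.
  by apply: le_trans (le_normcD _ _) _; rewrite nxy; move: tg; rewrite /g; lra.
have := ymin x xz; have := HM y x (near_r _ yz) (near_r _ xz).
rewrite nxy xy rlinearZ Lv => HMx.
(* Thus |F x - w| <= M t |v| + (1 - t) |w - F y|, and M |v| < lam |v| <= |w - F y| when v is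
   nonzero. *)
have -> : F x - w = (F x - F y - t%:C * (w - F y)) - (1 - t)%:C * (w - F y).
  by rewrite rmorphB rmorph1; ring.
have := le_normcB (F x - F y - t%:C * (w - F y)) ((1 - t)%:C * (w - F y)).
rewrite [normc ((1 - t)%:C * _)]normcM normc_real ger0_norm ?subr_ge0 //.
rewrite [normc (F y - w)]distcC => h1 h2.
have : M * (t * normc v) < t * normc (w - F y).
  have [v0|v0] := eqVneq (normc v) 0.
    by rewrite v0 !mulr0 mulr_gt0.
  have {}v0 : 0 < normc v by rewrite lt_neqAle eq_sym v0 normc_ge0.
  rewrite mulrCA ltr_pM2l //; apply: lt_le_trans vle.
  by rewrite ltr_pM2r.
by move: h1 h2 HMx; lra.
Qed.

Variable m : R -> R.
Hypothesis F_bound : forall z, normc z < r1 -> m (normc z) <= normc (F z - F 0).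

(** The circle |x| = r is sent outside the disk of radius m r about F 0. In that disk the images of
    the closed and of the open r-disk therefore coincide, so their trace is closed, open and
    nonempty, and connectedness makes it the whole disk. *)
Lemma nearly_linear_cover (r : R) w : 0 < r < r1 -> normc (w - F 0) < m r ->
  exists2 z, normc z < r1 & F z = w.
Proof.
move=> /andP[r0 rr1] wr.
pose K := F @` closed_disk 0 r; pose O := F @` disk 0 r.
have m0 : 0 < m r by apply: le_lt_trans wr; exact: normc_ge0.
have cK : closed K.
  apply: compact_closed; first exact: norm_hausdorff.
  apply: continuous_compact; last exact: closed_disk_compact.
  apply: continuous_in_subspaceT => x; rewrite inE /closed_disk /= subr0 => xr.
  by apply/cont_atP; apply: nearly_linear_cont; exact: le_lt_trans rr1.
have oO : open O.
  rewrite openE => _ [x /diskP + <-]; rewrite subr0 => xr.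
  have xr1 : normc x < r1 by exact: lt_trans rr1.
  have e0 : 0 < r - normc x by rewrite subr_gt0.
  have [d d0 hd] := nearly_linear_open xr1 e0.
  apply/nbhs_cplxP; exists d => // y /hd[x' [x'x _ <-]].
  exists x' => //; apply/diskP; rewrite subr0.
  have -> : x' = (x' - x) + x by rewrite subrK.
  by apply: le_lt_trans (le_normcD _ _) _; rewrite -ltrBrDr.
have KO : disk (F 0) (m r) `&` K = disk (F 0) (m r) `&` O.
  apply/seteqP; split => y [yr [x xr xy]]; split => //; exists x => //.
    move: xr; rewrite /closed_disk /= subr0 le_eqVlt => /orP[/eqP xr|xr].
      have xr1 : normc x < r1 by rewrite xr.
      by have /diskP := yr; rewrite ltNge -xy -xr F_bound.
    by apply/diskP; rewrite subr0.
  by move/diskP: xr; rewrite /closed_disk /= => /ltW.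
have /setIidPl sub : disk (F 0) (m r) `&` K = disk (F 0) (m r).
  apply: disk_connected; [|by exists O => //|by exists K].
  exists (F 0); split; first by apply/diskP; rewrite subrr normc0.
  have n0 : normc (0 - 0 : C) <= r by rewrite subrr normc0 ltW.
  by exists 0.
have /sub[z zr <-] : disk (F 0) (m r) w by exact/diskP.
exists z => //; move: zr; rewrite /closed_disk /= subr0 => zr.
exact: le_lt_trans rr1.
Qed.

End NearlyLinearMaps.

(** * Transport of a univalent disk through a change of variable *)

Section UnivalentDisks.
Variable R : realType.
Local Notation C := (cplx R).

(** Delta is the image of the covered disk under phi o F^-1. It is connected because F^-1 is
    continuous, F being open and injective. It is open because for y near a point of Delta, F (psi
    y) is still in the disk and y = phi (psi y). *)
Lemma univalent_disk_reparam (f F phi psi : C -> C) (r1 R0 rho : R) :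
  0 < R0 -> rho <= 1 ->
  (forall x, normc x < r1 -> cont_at F x) ->
  (forall x y, normc x < r1 -> normc y < r1 -> F x = F y -> x = y) ->
  (forall z (e : R), normc z < r1 -> 0 < e ->
    exists2 d : R, 0 < d & forall w, normc (w - F z) < d ->
    exists x, [/\ normc (x - z) < e, normc x < r1 & F x = w]) ->
  (forall w, normc (w - F 0) < R0 -> exists2 z, normc z < r1 & F z = w) ->
  (forall x, normc x < r1 -> [/\ normc (phi x) < rho, psi (phi x) = x,
     cont_at phi x, cont_at psi (phi x) & F x = f (phi x)]) ->
  (forall y, normc y < rho -> phi (psi y) = y) ->
  univalent_disk (@unit_disk R) f (F 0) R0.
Proof.
move=> R00 rho1 cF injF openF covF phiP psiP.
pose inv (w : C) : C := xget 0 [set z | normc z < r1 /\ F z = w].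
have invF x : normc x < r1 -> inv (F x) = x.
  move=> xr; rewrite /inv; case: xgetP => [y _ [yr Fy]|/(_ x)]; first exact: injF.
  by case.
have invP w : normc (w - F 0) < R0 -> normc (inv w) < r1 /\ F (inv w) = w.
  by move=> /covF[z zr <-]; rewrite invF.
have invc w : normc (w - F 0) < R0 -> cont_at inv w.
  move=> /invP[ir iw] e e0; have [d d0 hd] := openF _ e ir e0.
  exists d => // w' ww'.
  have [|x [xe xr <-]] := hd w'; first by rewrite iw.
  by rewrite invF.
split=> //; exists ((fun w => phi (inv w)) @` disk (F 0) R0); split.
- move=> _ [w /diskP /invP[ir _] <-]; apply/unit_diskP.
  by have [h _ _ _ _] := phiP _ ir; exact: lt_le_trans rho1.
- split.
  + rewrite openE => _ [w /diskP wR <-].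
    have [ir iw] := invP w wR; have [pr pK cp cq _] := phiP _ ir.
    set x := inv w in ir iw pr pK cp cq *.
    have g0 : 0 < R0 - normc (w - F 0) by rewrite subr_gt0.
    have [d d0 hd] := cF x ir _ g0.
    have d'0 : 0 < Num.min d (r1 - normc x) by rewrite lt_min d0 subr_gt0.
    have [e e0 he] := cq _ d'0.
    apply/nbhs_cplxP; exists (Num.min e (rho - normc (phi x))).
      by rewrite lt_min e0 subr_gt0.
    move=> y; rewrite lt_min => /andP[/he + yr]; rewrite pK lt_min => /andP[yd ye].
    have yrho : normc y < rho.
      have -> : y = (y - phi x) + phi x by rewrite subrK.
      by apply: le_lt_trans (le_normcD _ _) _; rewrite -ltrBrDr.
    have pyr : normc (psi y) < r1.
      have -> : psi y = (psi y - x) + x by rewrite subrK.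
      by apply: le_lt_trans (le_normcD _ _) _; rewrite -ltrBrDr.
    exists (F (psi y)); last by rewrite invF // psiP.
    apply/diskP; have -> : F (psi y) - F 0 = (F (psi y) - F x) + (w - F 0).
      by rewrite -iw; ring.
    by apply: le_lt_trans (le_normcD _ _) _; rewrite -ltrBrDr; exact: hd.
  + apply: connected_continuous_connected; first exact: disk_connected.
    apply: continuous_in_subspaceT => w; rewrite inE => /diskP wR.
    apply/cont_atP; apply: cont_at_comp; first exact: invc.
    by have [ir _] := invP w wR; have [_ _ h _ _] := phiP _ ir.
  + exists (phi (inv (F 0))); exists (F 0) => //.
    by apply/diskP; rewrite subrr normc0.
- have fE w : disk (F 0) R0 w -> f (phi (inv w)) = w.
    move=> /diskP/invP[ir iw].
    by have [_ _ _ _ <-] := phiP _ ir.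
  split.
  + by move=> _ [w wR <-]; rewrite /= fE.
  + move=> _ _ /set_mem[w wR <-] /set_mem[w' wR' <-].
    by rewrite !fE // => ->.
  + by move=> w wR; exists (phi (inv w)); [exists w|exact: fE].
Qed.

End UnivalentDisks.

(** * Landau's covering radius *)

Section Landau.
Variable R : realType.
Local Notation C := (cplx R).

(** Rotating B to the direction of A replaces a sum of two moduli by the modulus of one analytic
    expression H' + e G'; it also locates the direction in which a differential has maximal norm. *)
Lemma align_arguments (A B : C) :
  exists2 e : C, normc e = 1 & normc (A + e * B) = normc A + normc B.
Proof.
have [->|A0] := eqVneq A 0.
  by exists 1; rewrite ?normc1 // mul1r add0r normc0 add0r.
have [->|B0] := eqVneq B 0.
  by exists 1; rewrite ?normc1 // mulr0 addr0 normc0 addr0.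
have nA : 0 < normc A by rewrite normc_gt0.
have nB : 0 < normc B by rewrite normc_gt0.
have nC (x : R) : 0 < x -> x%:C != 0 :> C.
  by move=> x0; rewrite eq_complex /= eqxx andbT gt_eqF.
pose u : C := A / (normc A)%:C.
have uA : A = u * (normc A)%:C by rewrite /u divfK ?nC.
have u1 : normc u = 1.
  by rewrite normc_div normc_real gtr0_norm // divff // gt_eqF.
exists (u * (conjc B / (normc B)%:C)).
  by rewrite normcM u1 normc_div normc_conj normc_real gtr0_norm // mul1r divff ?gt_eqF.
have -> : u * (conjc B / (normc B)%:C) * B = u * (normc B)%:C.
  rewrite -mulrA; congr (_ * _); rewrite mulrAC [conjc B * B]mulrC mul_conjc.
  by rewrite rmorphXn /= expr2 mulfK ?nC.
rewrite {1}uA -mulrDr normcM u1 mul1r -rmorphD normc_real ger0_norm //.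
by rewrite addr_ge0 ?normc_ge0.
Qed.

Variables (H G H1 G1 : C -> C) (lam S t : R).
Hypothesis lam0 : 0 < lam.
Hypothesis S1 : 1 < S.
Hypothesis dH : forall x, normc x < 1 -> cderiv H x (H1 x).
Hypothesis dG : forall x, normc x < 1 -> cderiv G x (G1 x).
Hypothesis sH : forall x, normc x < 1 -> smooth 2 H x.
Hypothesis sG : forall x, normc x < 1 -> smooth 2 G x.
Hypothesis bHG : forall x, normc x < 1 -> normc (H1 x) + normc (G1 x) <= S * lam.
Hypothesis lamE : normc (H1 0) - normc (G1 0) = lam.

Hypothesis tE : t = S - S^-1.
Let F x : C := H x + conjc (G x).

Let S0 : 0 < S. Proof. exact: lt_trans ltr01 S1. Qed.

Let t0 : 0 < t.
Proof.
rewrite tE subr_gt0; apply: lt_trans S1.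
by rewrite invf_lt1.
Qed.

(** Let p' = H' + e G', with e aligning the two increments at x. As |p' 0| >= lam, the right-hand
    side of Schwarz-Pick is at most (S^2 - 1) lam^2 |x|; as |p' 0| <= S lam, the factor on the left
    is at least S lam (1 - |x|). The constant t is (S^2 - 1) / S. *)
Lemma landau_derivative x : normc x < 1 ->
  (normc (H1 x - H1 0) + normc (G1 x - G1 0)) * (1 - normc x) <=
  lam * t * normc x.
Proof.
move=> x1; have [e e1 eE] := align_arguments (H1 x - H1 0) (G1 x - G1 0).
pose p (y : C) : C := H y + e * G y; pose p1 (y : C) : C := H1 y + e * G1 y.
have Sl : 0 < S * lam by rewrite mulr_gt0.
have dp y : normc y < 1 -> cderiv p y (p1 y).
  by move=> y1; apply: cderivD; [exact: dH|exact/cderivZ/dG].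
have sp y : normc y < 1 -> smooth 2 p y.
  by move=> y1; apply: smoothD; [exact: sH|exact/smoothZ/sG].
have p1le y : normc y < 1 -> normc (p1 y) <= S * lam.
  move=> y1; apply: le_trans (bHG y1).
  by apply: le_trans (le_normcD _ _) _; rewrite normcM e1 mul1r.
have := schwarz_pick_deriv Sl dp sp p1le x1.
have -> : p1 x - p1 0 = (H1 x - H1 0) + e * (G1 x - G1 0) by rewrite /p1; ring.
rewrite eE.
have cS := p1le 0; rewrite normc0 ltr01 in cS; move: (cS isT) => {}cS.
have cl : lam <= normc (p1 0).
  by apply: le_trans (le_normc_addl _ _); rewrite normcM e1 mul1r lamE.
set c := normc (p1 0) in cS cl *.
set D := normc (H1 x - H1 0) + _; have D0 : 0 <= D by rewrite addr_ge0 ?normc_ge0.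
have x0 := normc_ge0 x; set r := normc x in x0 x1 *.
move=> HP.
have Hh : D * (1 - r) * (S * lam) <= lam * t * r * (S * lam).
  have -> : lam * t * r * (S * lam) = r * ((S * lam) ^+ 2 - lam ^+ 2).
    by rewrite tE; field; rewrite gt_eqF.
  have h1 : r * ((S * lam) ^+ 2 - c ^+ 2) <= r * ((S * lam) ^+ 2 - lam ^+ 2).
    rewrite ler_wpM2l // lerD2l lerN2 ler_pXn2r ?nnegrE // ?ltW //.
    exact: lt_le_trans lam0 cl.
  apply: le_trans h1; last apply: le_trans HP.
  have -> : D * (1 - r) * (S * lam) = D * (S * lam - S * lam * r) by ring.
  by rewrite ler_wpM2l // lerD2l lerN2 ler_wpM2r.
by rewrite ler_pM2r in Hh.
Qed.

(** The radius at which the Lipschitz constant lam t r / (1 - r) of the perturbation reaches lam. *)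
Let r1 := (1 + t)^-1.

Let r1_gt0 : 0 < r1. Proof. by rewrite invr_gt0 addr_gt0. Qed.

Let r1_lt1 : r1 < 1.
Proof.
have t1 : 0 < 1 + t by rewrite addr_gt0.
by rewrite /r1 (invf_lt1 t1) ltrDl.
Qed.

Lemma landau_nearly_linear (r : R) : 0 <= r < r1 -> exists2 M : R, M < lam &
  forall x y, normc x <= r -> normc y <= r ->
    normc (F y - F x - rlinear (H1 0) (G1 0) (y - x)) <= M * normc (y - x).
Proof.
move=> /andP[r0 rr1]; have rlt1 : r < 1 by exact: lt_trans r1_lt1.
have r1' : 0 < 1 - r by rewrite subr_gt0.
exists (lam * t * r / (1 - r)).
  rewrite ltr_pdivrMr // -mulrA ltr_pM2l // ltrBrDr.
  by move: rr1; rewrite /r1 -[_^-1]mul1r ltr_pdivlMr ?addr_gt0 //; lra.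
move=> x y xr yr.
have seg (s : R) : 0 <= s <= 1 -> normc (x + s%:C * (y - x)) <= r.
  move=> /andP[s0 s1].
  have -> : x + s%:C * (y - x) = (1 - s)%:C * x + s%:C * y.
    by rewrite rmorphB rmorph1; ring.
  apply: le_trans (le_normcD _ _) _.
  rewrite !normcM !normc_real !ger0_norm ?subr_ge0 //; nra.
have -> : F y - F x = H (x + (y - x)) + conjc (G (x + (y - x))) - (H x + conjc (G x)).
  by rewrite [x + (y - x)]addrC subrK.
apply: (harmonic_lipschitz (H1 := H1) (G1 := G1)) => s /seg sr.
- by apply: dH; exact: le_lt_trans rlt1.
- by apply: dG; exact: le_lt_trans rlt1.
- have s1 : normc (x + s%:C * (y - x)) < 1 by exact: le_lt_trans rlt1.
  rewrite ler_pdivlMr //; have := landau_derivative s1.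
  set D := normc _ + normc _; set rs := normc _ in s1 sr *.
  have D0 : 0 <= D by rewrite addr_ge0 ?normc_ge0.
  have lt0 : 0 < lam * t by rewrite mulr_gt0.
  move: (lam * t) lt0 => k k0 h; nra.
Qed.

(** The integral of lam (1 - t s / (1 - s)) over [0, r]; the integrand vanishes at s = [r1], and m
    r1 is [landau_radius]. *)
Let m (r : R) := lam * (r + t * (r + ln (1 - r))).

Lemma is_derive_log_bound (k r x : R) : x * r < 1 ->
  is_derive x 1 (fun s => k * (- (s * r) - ln (1 - s * r)))
    (k * (r * (x * r) / (1 - x * r))).
Proof.
move=> xr; have xr0 : 0 < 1 - x * r by rewrite subr_gt0.
have d1 : is_derive x 1 (fun s : R => s * r) r by exact: is_derive_linear.
have d2 : is_derive x 1 (fun s : R => 1 - s * r) (0 - r).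
  by apply: is_deriveB; exact: is_derive_cst.
have d3 : is_derive x 1 (fun s : R => ln (1 - s * r)) ((1 - x * r)^-1 * (0 - r)).
  have dl : is_derive ((fun s : R => 1 - s * r) x) 1 (@ln R) (1 - x * r)^-1.
    exact: is_derive1_ln.
  exact: (@is_derive1_comp R (@ln R) (fun s : R => 1 - s * r) x _ _ dl d2).
have d4 : is_derive x 1 (fun s : R => k *: (- (s * r) - ln (1 - s * r)))
    (k *: (- r - (1 - x * r)^-1 * (0 - r))).
  by apply: is_deriveZ; apply: is_deriveB; apply: is_deriveN.
apply: is_derive_eq d4 _; rewrite /GRing.scale /=; field.
by rewrite gt_eqF.
Qed.

Lemma landau_growth z : normc z < r1 -> m (normc z) <= normc (F z - F 0).
Proof.
move=> zr; have z1 : normc z < 1 by exact: lt_trans r1_lt1.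
pose B (s : R) := lam * t * (- (s * normc z) - ln (1 - s * normc z)).
pose B' (s : R) := lam * t * (normc z * (s * normc z) / (1 - s * normc z)).
have z0 := normc_ge0 z.
have sz (s : R) : 0 <= s <= 1 -> s * normc z < 1.
  by move=> /andP[s0 s1]; apply: le_lt_trans z1; rewrite ler_piMl.
have nsz (s : R) : 0 <= s <= 1 -> normc (0 + s%:C * z) = s * normc z.
  by move=> /andP[s0 s1]; rewrite add0r normcM normc_real ger0_norm.
have := @harmonic_mean_value R H G H1 G1 (H1 0) (G1 0) 0 z B B'.
rewrite add0r => HM; have {}HM : normc (F z - F 0 - rlinear (H1 0) (G1 0) z) <= B 1 - B 0.
  apply: HM => s s01.
  - by apply: dH; rewrite nsz ?sz.
  - by apply: dG; rewrite nsz ?sz.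
  - exact/is_derive_log_bound/sz.
  - have s1 : normc (0 + s%:C * z) < 1 by rewrite nsz ?sz.
    have := landau_derivative s1; rewrite nsz //.
    rewrite -ler_pdivlMr ?subr_gt0 ?sz // => h.
    apply: le_trans (ler_wpM2l z0 h) _.
    by rewrite /B' le_eqVlt; apply/orP; left; apply/eqP; ring.
have := rlinear_ge (H1 0) (G1 0) z; rewrite lamE.
have := le_normc_subl (rlinear (H1 0) (G1 0) z) (rlinear (H1 0) (G1 0) z - (F z - F 0)).
have -> : rlinear (H1 0) (G1 0) z -
  (rlinear (H1 0) (G1 0) z - (F z - F 0)) = F z - F 0 by ring.
rewrite distcC; move: HM; rewrite /B /m !mul1r !mul0r subr0 ln1; lra.
Qed.

Definition landau_radius := lam * (1 + t * ln (t / (1 + t))).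

(** This amounts to t ln (1 + 1/t) < 1, that is 1 + 1/t < exp (1/t). *)
Lemma landau_radius_gt0 : 0 < landau_radius.
Proof.
rewrite /landau_radius mulr_gt0 //.
have t1 : 0 < 1 + t by rewrite addr_gt0.
have -> : t / (1 + t) = (1 + t^-1)^-1.
  by field; rewrite !gt_eqF //= addrC.
have tV1 : 0 < 1 + t^-1 by rewrite addr_gt0 // invr_gt0.
rewrite lnV ?posrE // mulrN subr_gt0 -ltr_pdivlMl // mulr1.
rewrite -[ltRHS]expRK ltr_ln ?posrE ?expR_gt0 //.
by apply: expR_gt1Dx; rewrite invr_eq0 gt_eqF.
Qed.

Lemma landau_cover w : normc (w - F 0) < landau_radius ->
  exists2 z, normc z < r1 & F z = w.
Proof.
move=> wR.
have t1 : 0 < 1 + t by rewrite addr_gt0.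
(* Since ln (1 - r1) <= ln (1 - r), m r1 - m r <= lam (1 + t) (r1 - r). With r1 - r <= d this is at
   most half of the gap, so |w - F 0| < m r. *)
pose d := (landau_radius - normc (w - F 0)) / (2 * lam * (1 + t)).
have d0 : 0 < d by rewrite divr_gt0 ?subr_gt0 // !mulr_gt0.
pose r := Num.max (r1 / 2) (r1 - d).
have rr : 0 < r < r1.
  rewrite /r lt_max gt_max divr_gt0 //= ltrBlDr ltrDl d0 andbT.
  by rewrite ltr_pdivrMr // ltr_pMr // ltr1n.
have rd : r1 - r <= d by rewrite lerBlDr -lerBlDl /r le_max lexx orbT.
apply: (@nearly_linear_cover R F (H1 0) (G1 0) r1 _ _ m _ r w) => //.
- by rewrite lamE.
- by rewrite lamE; exact: landau_nearly_linear.
- exact: landau_growth.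
have -> : normc (w - F 0) = landau_radius - d * (2 * lam * (1 + t)).
  by rewrite /d divfK ?gt_eqF ?mulr_gt0 //; ring.
have RE : landau_radius = m r1.
  rewrite /landau_radius /m; have -> : 1 - r1 = t / (1 + t).
    by rewrite /r1; field; rewrite gt_eqF.
  congr (_ * _); rewrite mulrDr addrA; congr (_ + _).
  by rewrite /r1; field; rewrite gt_eqF.
have lnr : ln (1 - r1) <= ln (1 - r).
  case/andP: rr => r0 rr; rewrite ler_ln ?posrE ?subr_gt0 //; first by lra.
  exact: lt_trans r1_lt1.
rewrite RE /m; move: (ln (1 - r1)) (ln (1 - r)) lnr => l1 l2 l12.
have dd : d * (2 * lam * (1 + t)) > (r1 - r) * (lam * (1 + t)).
  have lt1 : 0 < lam * (1 + t) by rewrite mulr_gt0.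
  have -> : d * (2 * lam * (1 + t)) = 2 * d * (lam * (1 + t)) by ring.
  by rewrite ltr_pM2r //; lra.
have : 0 <= lam * t * (l2 - l1) by rewrite mulr_ge0 ?subr_ge0 // mulr_ge0 ?ltW.
lra.
Qed.

Lemma landau_univalent_disk (f phi psi : C -> C) (rho : R) : rho <= 1 ->
  (forall x, normc x < 1 -> [/\ normc (phi x) < rho, psi (phi x) = x,
     cont_at phi x, cont_at psi (phi x) & F x = f (phi x)]) ->
  (forall y, normc y < rho -> phi (psi y) = y) ->
  univalent_disk (@unit_disk R) f (F 0) landau_radius.
Proof.
move=> rho1 phiP psiP.
have ab0 : 0 < normc (H1 0) - normc (G1 0) by rewrite lamE.
have lin r : 0 <= r < r1 -> exists2 M : R, M < normc (H1 0) - normc (G1 0) &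
  forall x y, normc x <= r -> normc y <= r ->
    normc (F y - F x - rlinear (H1 0) (G1 0) (y - x)) <= M * normc (y - x).
  by rewrite lamE; exact: landau_nearly_linear.
apply: (univalent_disk_reparam (phi := phi) (psi := psi) (rho := rho) (r1 := r1)) => //.
- exact: landau_radius_gt0.
- exact: nearly_linear_cont lin.
- exact: nearly_linear_injective lin.
- exact: nearly_linear_open lin.
- exact: landau_cover.
- by move=> x xr; apply: phiP; exact: lt_trans r1_lt1.
Qed.

End Landau.

(** * Bloch's renormalization *)

Section Bloch.
Variable R : realType.
Local Notation C := (cplx R).

Lemma cderiv_slope (f s : C -> C) (z : C) : cont_at s z ->
  (\forall x \near z, f x = f z + (x - z) * s x) -> cderiv f z (s z).
Proof.
move=> cs /near_cplxP[d d0 fs]; apply: cderiv_near => e /cs[d' d'0 hd'].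
exists (Num.min d d'); first by rewrite lt_min d0.
move=> x; rewrite lt_min => /andP[/fs -> /hd' /ltW xe].
have -> : f z + (x - z) * s x - f z - (x - z) * s z = (s x - s z) * (x - z) by ring.
by rewrite normcM ler_wpM2r ?normc_ge0.
Qed.

Lemma mobius_identity (k : R) (a x : R[i]) :
  (1 - normc a ^+ 2) * (1 - k ^+ 2 * normc x ^+ 2) =
  normc (1 + conjc a * k%:C * x) ^+ 2 - normc (k%:C * x + a) ^+ 2.
Proof. by rewrite !normc_sqrE; case: x a => p q [p' q'] /=; ring. Qed.

Section Mobius.
Variables (k rho : R) (a : C).
Hypothesis k01 : 0 < k < 1.
Hypothesis rho0 : 0 < rho.
Hypothesis a1 : normc a < 1.

Let ca := conjc a.
Let den (x : C) : C := 1 + ca * k%:C * x.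
Let den' (y : C) : C := 1 - ca * (y / rho%:C).

(** The contraction by k, then the disk automorphism moving 0 to a, then the dilation by rho: k
    accounts for the restriction to a smaller disk, rho for the passage to f (rho z). *)
Definition mobius (x : C) : C := rho%:C * (k%:C * x + a) / den x.
Definition mobius_deriv (x : C) : C :=
  rho%:C * k%:C * (1 - a * ca) / den x ^+ 2.
Definition mobius_inv (y : C) : C := k%:C^-1 * ((y / rho%:C - a) / den' y).

Let k0 : 0 < k. Proof. by case/andP: k01. Qed.
Let kC0 : k%:C != 0 :> C.
Proof. by rewrite eq_complex /= eqxx andbT gt_eqF. Qed.
Let rC0 : rho%:C != 0 :> C.
Proof. by rewrite eq_complex /= eqxx andbT gt_eqF. Qed.

Lemma one_sub_unit_neq0 (w : C) : normc w < 1 -> 1 - w != 0.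
Proof.
move=> w1; rewrite subr_eq0; apply: contraTneq w1 => <-.
by rewrite normc1 ltxx.
Qed.

Lemma mobius_den_neq0 x : normc x < 1 -> den x != 0.
Proof.
move=> x1; rewrite /den -[ca * _ * _]opprK; apply: one_sub_unit_neq0.
rewrite normcN !normcM normc_conj normc_real gtr0_norm // -mulrA.
have [_ k1] := andP k01.
by rewrite mulr_ilt1 ?mulr_ge0 ?normc_ge0 ?(ltW k0) // mulr_ilt1 ?normc_ge0 ?(ltW k0).
Qed.

Lemma mobius_inv_den_neq0 y : normc y < rho -> den' y != 0.
Proof.
move=> yr; apply: one_sub_unit_neq0.
rewrite normcM normc_conj normc_div normc_real gtr0_norm //.
have yr1 : normc y / rho < 1 by rewrite ltr_pdivrMr // mul1r.
have y0 : 0 <= normc y / rho by rewrite divr_ge0 ?normc_ge0 ?ltW.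
by rewrite mulr_ilt1 ?normc_ge0.
Qed.

Lemma mobius_smooth n x : normc x < 1 -> smooth n mobius x.
Proof.
move=> x1; apply: smoothM.
  apply: smoothZ; apply: smoothD; last exact: smooth_cst.
  by apply: smoothZ; exact: smooth_id.
apply: smoothV; first exact: mobius_den_neq0.
apply: smoothD; first exact: smooth_cst.
by apply: smoothZ; exact: smooth_id.
Qed.

Lemma mobius_inv_smooth n y : normc y < rho -> smooth n mobius_inv y.
Proof.
move=> y1; apply: smoothZ; apply: smoothM.
  apply: smoothB; last exact: smooth_cst.
  by apply: smoothM; [exact: smooth_id|exact: smooth_cst].
apply: smoothV; first exact: mobius_inv_den_neq0.
apply: smoothB; first exact: smooth_cst.
by apply: smoothZ; apply: smoothM; [exact: smooth_id|exact: smooth_cst].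
Qed.

Lemma near_unit (x : C) : normc x < 1 -> \forall y \near x, normc y < 1.
Proof.
move=> x1; apply/near_cplxP; exists (1 - normc x); first by rewrite subr_gt0.
move=> y yx; have -> : y = (y - x) + x by rewrite subrK.
by apply: le_lt_trans (le_normcD _ _) _; rewrite -ltrBrDr.
Qed.

Lemma mobius_cderiv x : normc x < 1 -> cderiv mobius x (mobius_deriv x).
Proof.
move=> x1; have dx := mobius_den_neq0 x1.
pose s (y : C) : C := rho%:C * k%:C * (1 - a * ca) / den x * (den y)^-1.
have -> : mobius_deriv x = s x by rewrite /mobius_deriv /s; field.
apply: cderiv_slope.
  apply: (@smooth_cont R 0); apply: smoothZ; apply: smoothV => //.
  apply: smoothD; first exact: smooth_cst.
  by apply: smoothZ; exact: smooth_id.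
have /near_cplxP[d d0 hd] := near_unit x1.
apply/near_cplxP; exists d => // y /hd /mobius_den_neq0.
move: dx; rewrite /mobius /s /den => dx dy; field.
by rewrite dx dy.
Qed.

(* The invariance of the Poincare metric under disk automorphisms. *)
Lemma mobius_metric x : normc x < 1 -> exists2 z : C, normc z < 1 &
  mobius x = rho%:C * z /\
  normc (mobius_deriv x) * (1 - k ^+ 2 * normc x ^+ 2) = rho * k * (1 - normc z ^+ 2).
Proof.
move=> x1; have dx := mobius_den_neq0 x1.
pose z : C := (k%:C * x + a) / den x.
have nd : 0 < normc (den x) ^+ 2 by rewrite exprn_gt0 // normc_gt0.
have na2 : 0 < 1 - normc a ^+ 2.
  by rewrite subr_gt0 expr_lt1 ?normc_ge0.
have kx : k ^+ 2 * normc x ^+ 2 < 1.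
  have [_ k1] := andP k01; rewrite -exprMn expr_lt1 ?mulr_ge0 ?normc_ge0 ?(ltW k0) //.
  by rewrite mulr_ilt1 ?normc_ge0 ?(ltW k0).
have zE : 1 - normc z ^+ 2 =
    (1 - normc a ^+ 2) * (1 - k ^+ 2 * normc x ^+ 2) / normc (den x) ^+ 2.
  rewrite /z normc_div expr_div_n.
  have -> : (1 - normc a ^+ 2) * (1 - k ^+ 2 * normc x ^+ 2) =
      normc (den x) ^+ 2 - normc (k%:C * x + a) ^+ 2.
    exact: mobius_identity.
  by field; rewrite gt_eqF // normc_gt0.
exists z; last split.
- rewrite -(@ltr_pXn2r _ 2) ?nnegrE ?normc_ge0 // expr1n -subr_gt0 zE.
  by rewrite divr_gt0 // mulr_gt0 // subr_gt0.
- by rewrite /mobius /z mulrA.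
have aC : 1 - a * ca = (1 - normc a ^+ 2)%:C.
  by rewrite /ca mul_conjc rmorphB.
rewrite zE /mobius_deriv normc_div normcX aC !normcM !normc_real.
by rewrite !gtr0_norm //; ring.
Qed.

Lemma mobius_invK x : normc x < 1 -> mobius_inv (mobius x) = x.
Proof.
move=> x1; have dx := mobius_den_neq0 x1.
have [z z1 [mE _]] := mobius_metric x1.
have mr : normc (mobius x) < rho.
  by rewrite mE normcM normc_real gtr0_norm // gtr_pMr.
have dy := mobius_inv_den_neq0 mr.
apply: (mulfI dy); rewrite /mobius_inv mulrCA [den' _ * _]mulrC divfK //.
by move: dx; rewrite /den' /mobius /den => dx; field; rewrite dx rC0 kC0.
Qed.

(** [mobius_inv y] may leave the unit disk, having modulus up to 1 / k, so [mobius_den_neq0] does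
    not apply; the denominator there is computed as (1 - |a|^2) / den' y. *)
Lemma mobiusK y : normc y < rho -> mobius (mobius_inv y) = y.
Proof.
move=> yr; have dy := mobius_inv_den_neq0 yr.
have dy' : rho%:C - ca * y != 0.
  have -> : rho%:C - ca * y = rho%:C * den' y by rewrite /den'; field.
  by rewrite mulf_neq0.
have aC : 1 - a * ca != 0.
  rewrite mulrC; apply: one_sub_unit_neq0.
  by rewrite normcM normc_conj mulr_ilt1 ?normc_ge0.
have dE : den (mobius_inv y) = (1 - a * ca) / den' y.
  by rewrite /den /mobius_inv /den'; field; rewrite dy' rC0 kC0.
have dx : den (mobius_inv y) != 0 by rewrite dE mulf_neq0 ?invr_eq0.
apply: (mulIf dx); rewrite /mobius divfK // dE.
rewrite /mobius_inv /den'; field; rewrite ?dy' ?rC0 ?kC0 //.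
Qed.

End Mobius.

End Bloch.

(** * Ellipticity of the renormalized map, and the choice of its centre *)

Section BlochLandau.
Variable R : realType.
Local Notation C := (cplx R).
Variables (K K' : R) (f h g h1 g1 : C -> C).
Hypothesis K1 : 1 <= K.
Hypothesis K'0 : 0 <= K'.
Hypothesis dh : forall x, normc x < 1 -> cderiv h x (h1 x).
Hypothesis dg : forall x, normc x < 1 -> cderiv g x (g1 x).
Hypothesis sh : forall x, normc x < 1 -> smooth 2 h x.
Hypothesis sg : forall x, normc x < 1 -> smooth 2 g x.
Hypothesis ch1 : forall x, normc x < 1 -> cont_at h1 x.
Hypothesis cg1 : forall x, normc x < 1 -> cont_at g1 x.
Hypothesis fE : forall x, normc x < 1 -> f x = h x + conjc (g x).

Let Lam (x : C) : R := normc (h1 x) + normc (g1 x).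
Let lam (x : C) : R := normc (h1 x) - normc (g1 x).
Hypothesis ell : forall x, normc x < 1 -> Lam x ^+ 2 <= K * (Lam x * lam x) + K'.

(** The positive root of X^2 = 2 K X + 4 K' (K + K') when K' > 0, and 2 K when K' = 0. *)
Let S := K + Num.sqrt (K ^+ 2 + 4 * K' * (K + K')).

Let KK0 : 0 < K + K'. Proof. by rewrite ltr_pwDl // (lt_le_trans ltr01). Qed.

Let disc0 : 0 <= K ^+ 2 + 4 * K' * (K + K').
Proof. by rewrite addr_ge0 ?sqr_ge0 // !mulr_ge0 // ltW. Qed.

Let S_eq : S ^+ 2 = 2 * K * S + 4 * K' * (K + K').
Proof.
by rewrite /S sqrrD sqr_sqrtr //; set q := Num.sqrt _; ring.
Qed.

Let S_ge2K : 2 * K <= S.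
Proof.
have : K <= Num.sqrt (K ^+ 2 + 4 * K' * (K + K')).
  rewrite -{1}(ger0_norm (le_trans ler01 K1)) -sqrtr_sqr ler_wsqrtr // lerDl.
  by rewrite !mulr_ge0 // ltW.
by rewrite /S; lra.
Qed.

Let S_gt1 : 1 < S.
Proof. by move: S_ge2K K1; lra. Qed.

Let tKK_eq : tKK K K' = S - S^-1.
Proof.
have S0 : S != 0 by rewrite gt_eqF // (lt_trans ltr01).
rewrite /tKK -/S; have -> : 4 * K' * (K + K') = S ^+ 2 - 2 * K * S.
  by rewrite S_eq; ring.
by field.
Qed.

Lemma bloch_normalized (rho : R) (a : C) :
  0 < rho <= 1 -> normc a < 1 ->
  let M := rho * (1 - normc a ^+ 2) * lam (rho%:C * a) in
  0 < M -> 1 <= M ^+ 2 * (K + K') ->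
  (forall z, normc z < 1 -> rho * (1 - normc z ^+ 2) * lam (rho%:C * z) <= M) ->
  exists (w : C) (r : R), rho2 K K' <= r /\ univalent_disk (@unit_disk R) f w r.
Proof.
move=> /andP[rho0 rho1] a1 M M0 MK maxM.
(* With k^2 = 1/2, the factor 1 / (1 - k^2 |x|^2) coming from [mobius_metric] is at most 2, at the
   price of the factor k in l_F(0) = k M. *)
pose k : R := (Num.sqrt 2)^-1.
have s2 : 0 < Num.sqrt (2 : R) by rewrite sqrtr_gt0.
have k2 : k ^+ 2 = 2^-1 by rewrite /k exprVn sqr_sqrtr.
have k0 : 0 < k by rewrite invr_gt0.
have k01 : 0 < k < 1.
  by rewrite k0 -(@ltr_pXn2r _ 2) ?nnegrE ?ltW // k2 expr1n invf_lt1 // ltr1n.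
pose phi := mobius k rho a; pose phi1 := mobius_deriv k rho a.
have phiP x : normc x < 1 -> exists2 z : C, normc z < 1 & phi x = rho%:C * z /\
    normc (phi1 x) * (1 - k ^+ 2 * normc x ^+ 2) = rho * k * (1 - normc z ^+ 2).
  exact: mobius_metric.
have phi_lt x : normc x < 1 -> normc (phi x) < rho.
  move=> /phiP[z z1 [-> _]]; rewrite normcM normc_real gtr0_norm //.
  by rewrite gtr_pMr.
have phi_lt1 x : normc x < 1 -> normc (phi x) < 1.
  by move=> /phi_lt xr; exact: lt_le_trans rho1.
have phi0 : phi 0 = rho%:C * a.
  by rewrite /phi /mobius !mulr0 add0r addr0 divr1.
have n01 : normc (0 : C) < 1 by rewrite normc0.
have phi10 : normc (phi1 0) = rho * k * (1 - normc a ^+ 2).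
  have [z z1 [zE]] := phiP 0 n01; rewrite normc0 expr0n mulr0 subr0 mulr1 => ->.
  have -> : a = z => //; apply: (@mulfI _ (rho%:C : C)); last by rewrite -zE phi0.
  by rewrite eq_complex /= eqxx andbT gt_eqF.
pose H x := h (phi x); pose G x := g (phi x).
pose H1 x := h1 (phi x) * phi1 x; pose G1 x := g1 (phi x) * phi1 x.
have lamE : normc (H1 0) - normc (G1 0) = k * M.
  rewrite /H1 /G1 [normc (h1 _ * _)]normcM [normc (g1 _ * _)]normcM.
  by rewrite phi10 phi0 -mulrBl /M /lam; ring.
have kM0 : 0 < k * M by rewrite mulr_gt0.
have bHG x : normc x < 1 -> normc (H1 x) + normc (G1 x) <= S * (k * M).
  move=> x1; have [z z1 [zE dE]] := phiP x x1.
  rewrite /H1 /G1 [normc (h1 _ * _)]normcM [normc (g1 _ * _)]normcM.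
  rewrite -mulrDl -/(Lam (phi x)).
  set P := normc (phi1 x) in dE *; have P0 : 0 <= P by exact: normc_ge0.
  have x2 : normc x ^+ 2 <= 1 by rewrite expr_le1 ?normc_ge0 // ltW.
  have Pz : P <= 2 * (rho * k * (1 - normc z ^+ 2)).
    by rewrite -dE k2; nra.
  have z2 : 0 <= 1 - normc z ^+ 2 by rewrite subr_ge0 expr_le1 ?normc_ge0 // ltW.
  have P2k : P <= 2 * k.
    apply: le_trans Pz _; rewrite ler_pM2l // mulrAC ler_piMl ?(ltW k0) //.
    rewrite mulr_ile1 // ?(ltW rho0) //.
    by rewrite lerBlDr lerDl sqr_ge0.
  (* Here 1 <= M^2 (K + K') is used to absorb the additive constant K' P^2 into a multiple of (k
     M)^2; ellipticity of F becomes homogeneous in L_F and l_F(0). *)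
  have PP : P ^+ 2 <= 4 * (k * M) ^+ 2 * (K + K').
    apply: (@le_trans _ _ ((2 * k) ^+ 2)).
      by rewrite ler_pXn2r ?nnegrE // mulr_ge0 // ltW.
    have -> : 4 * (k * M) ^+ 2 * (K + K') = (2 * k) ^+ 2 * (M ^+ 2 * (K + K')) by ring.
    by rewrite ler_peMr ?sqr_ge0.
  have Plam : P * lam (phi x) <= 2 * (k * M).
    have [l0|l0] := leP 0 (lam (phi x)); last first.
      apply: (@le_trans _ _ 0); last by rewrite mulr_ge0 ?ltW.
      by rewrite mulr_ge0_le0 // ltW.
    apply: le_trans (ler_wpM2r l0 Pz) _.
    have -> : 2 * (rho * k * (1 - normc z ^+ 2)) * lam (phi x) =
       2 * k * (rho * (1 - normc z ^+ 2) * lam (phi x)) by ring.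
    by rewrite [2 * (k * M)]mulrA ler_pM2l ?mulr_gt0 // zE maxM.
  have L0 : 0 <= Lam (phi x) by rewrite addr_ge0 ?normc_ge0.
  have LP : (Lam (phi x) * P) ^+ 2 <=
      2 * K * (k * M) * (Lam (phi x) * P) + 4 * K' * (K + K') * (k * M) ^+ 2.
    rewrite exprMn; apply: le_trans (ler_wpM2r (sqr_ge0 P) (ell (phi_lt1 _ x1))) _.
    rewrite mulrDl; apply: lerD.
      have -> : K * (Lam (phi x) * lam (phi x)) * P ^+ 2 =
         (K * (Lam (phi x) * P)) * (P * lam (phi x)) by ring.
      have -> : 2 * K * (k * M) * (Lam (phi x) * P) =
         (K * (Lam (phi x) * P)) * (2 * (k * M)) by ring.
      by rewrite ler_wpM2l // !mulr_ge0 // (le_trans ler01).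
    have -> : 4 * K' * (K + K') * (k * M) ^+ 2 = K' * (4 * (k * M) ^+ 2 * (K + K')).
      by ring.
    by rewrite ler_wpM2l.
  rewrite leNgt; apply/negP => lt_S.
  (* By the equation of S, with X = L_F and Y = k M this product equals X^2 - 2 K X Y - 4 K' (K +
     K') Y^2, which LP bounds by 0. *)
  have : 0 < (Lam (phi x) * P - S * (k * M)) * (Lam (phi x) * P + (S - 2 * K) * (k * M)).
    rewrite mulr_gt0 ?subr_gt0 // ltr_pwDl //.
      by apply: lt_trans lt_S; rewrite mulr_gt0 // (lt_trans ltr01).
    by rewrite mulr_ge0 ?(ltW kM0) // subr_ge0.
  move: LP; set X := Lam (phi x) * P; set Y := k * M; move: S_eq; nra.
have radius := @landau_radius_gt0 R (k * M) S (tKK K K') kM0 S_gt1 tKK_eq.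
have := @landau_univalent_disk R H G H1 G1 (k * M) S (tKK K K') kM0 S_gt1.
rewrite /rho2; move: (tKK K K') tKK_eq radius => t tE radius LU.
exists (H 0 + conjc (G 0)), (landau_radius (k * M) t); split.
  (* Positivity of the radius makes the common factor 1 + t ln (t / (1 + t)) positive; what remains
     is 1 / sqrt (2 (K + K')) <= k M, the square root of MK. *)
  move: radius; rewrite /landau_radius pmulr_rgt0 // => radius.
  rewrite ler_pM2r // -[_^-1]mul1r ler_pdivrMr ?sqrtr_gt0 ?mulr_gt0 //.
  have kMs : 0 <= k * M * Num.sqrt (2 * (K + K')).
    by apply: mulr_ge0; [exact: ltW|exact: sqrtr_ge0].
  rewrite -(@ler_pXn2r _ 2) ?nnegrE //.
  have sE : Num.sqrt (2 * (K + K')) ^+ 2 = 2 * (K + K').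
    by rewrite sqr_sqrtr // mulr_ge0 // ltW.
  rewrite expr1n; apply: le_trans MK _; rewrite le_eqVlt; apply/orP; left; apply/eqP.
  by rewrite [(k * M * _) ^+ 2]exprMn sE [(k * M) ^+ 2]exprMn k2; field.
have dH x : normc x < 1 -> cderiv H x (H1 x).
  by move=> x1; apply: cderiv_comp; [exact: mobius_cderiv|exact/dh/phi_lt1].
have dG x : normc x < 1 -> cderiv G x (G1 x).
  by move=> x1; apply: cderiv_comp; [exact: mobius_cderiv|exact/dg/phi_lt1].
have sH x : normc x < 1 -> smooth 2 H x.
  by move=> x1; apply: smooth_comp; [exact: mobius_smooth|exact/sh/phi_lt1].
have sG x : normc x < 1 -> smooth 2 G x.
  by move=> x1; apply: smooth_comp; [exact: mobius_smooth|exact/sg/phi_lt1].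
apply: (LU dH dG sH sG bHG lamE tE f phi (mobius_inv k rho a) rho rho1).
- move=> x x1; split.
  + exact: phi_lt.
  + exact: mobius_invK.
  + exact: smooth_cont (mobius_smooth rho k01 a1 0 x1).
  + exact: smooth_cont (mobius_inv_smooth k rho0 a1 0 (phi_lt x x1)).
  + by rewrite fE // phi_lt1.
- by move=> y yr; exact: mobiusK.
Qed.

Lemma lam_cont x : normc x < 1 -> rcont_at lam x.
Proof.
by move=> x1; apply: rcont_atB; apply: rcont_at_normc; auto.
Qed.

Lemma bloch_disk : Lam 0 * lam 0 = 1 ->
  exists (w : C) (r : R), rho2 K K' <= r /\ univalent_disk (@unit_disk R) f w r.
Proof.
move=> J0; have n01 : normc (0 : C) < 1 by rewrite normc0.
have L0 : 0 <= Lam 0 by rewrite addr_ge0 ?normc_ge0.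
have l0 : 0 < lam 0.
  by rewrite ltNge; apply/negP => ln; have := mulr_ge0_le0 L0 ln; rewrite J0; lra.
have l0K : 1 <= lam 0 ^+ 2 * (K + K').
  have := ell n01; rewrite J0 mulr1 => LK.
  apply: le_trans (ler_wpM2l (sqr_ge0 _) LK).
  by rewrite -exprMn [lam 0 * _]mulrC J0 expr1n.
have M0E : 1 * (1 - normc (0 : C) ^+ 2) * lam (1%:C * 0) = lam 0.
  by rewrite normc0 expr0n subr0 mulr0 !mul1r.
have [glob|/existsNP[z /not_implyP[z1 /negP]]] :=
  pselect (forall z, normc z < 1 -> (1 - normc z ^+ 2) * lam z <= lam 0).
  apply: (@bloch_normalized 1 0); rewrite ?M0E ?ltr01 ?lexx //.
  by move=> z z1; rewrite !mul1r glob.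
rewrite -ltNge => lz.
have z2 : normc z ^+ 2 < 1 by rewrite expr_lt1 ?normc_ge0.
have lz0 : 0 < lam z.
  rewrite ltNge; apply/negP => ln.
  have : (1 - normc z ^+ 2) * lam z <= 0 by rewrite mulr_ge0_le0 // subr_ge0 ltW.
  by move: lz l0; lra.
(* This makes (1 - |z|^2 / rho^2) lam z = lam 0 / rho^2, so that u (z / rho) = lam 0 / rho >= lam 0.
   The condition rho < 1 is exactly lam 0 < (1 - |z|^2) lam z. *)
pose q := lam 0 / lam z + normc z ^+ 2; pose rho := Num.sqrt q.
have q0 : 0 < q by rewrite ltr_pwDl ?sqr_ge0 // divr_gt0.
have q1 : q < 1 by rewrite /q -ltrBrDr ltr_pdivrMr.
have rho2E : rho ^+ 2 = q by rewrite sqr_sqrtr // ltW.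
have rho0 : 0 < rho by rewrite sqrtr_gt0.
have rho1 : rho < 1 by rewrite -(@ltr_pXn2r _ 2) ?nnegrE ?ltW // rho2E expr1n.
have nrho (x : C) : normc (rho%:C * x) = rho * normc x.
  by rewrite normcM normc_real gtr0_norm.
have rholt (x : C) : normc x <= 1 -> normc (rho%:C * x) < 1.
  move=> x1; rewrite nrho; apply: le_lt_trans rho1.
  by rewrite ler_piMr // ltW.
pose u (x : C) := rho * (1 - normc x ^+ 2) * lam (rho%:C * x).
have cu (x : C) : normc (x - 0) <= 1 -> rcont_at u x.
  rewrite subr0 => x1; apply: rcont_atM.
    apply: rcont_atM; first exact: rcont_at_cst.
    apply: rcont_atB; first exact: rcont_at_cst.
    exact/rcont_atX/rcont_at_normc/cont_at_id.
  apply: (@rcont_at_comp R lam (fun x => rho%:C * x)).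
    by apply: cont_atM; [exact: cont_at_cst|exact: cont_at_id].
  exact/lam_cont/rholt.
have [a a1 amax] := rcont_max ler01 cu.
rewrite subr0 in a1.
pose b : C := z / rho%:C.
have bE : rho%:C * b = z.
  by rewrite mulrC divfK // eq_complex /= eqxx andbT gt_eqF.
have nb2 : normc b ^+ 2 = normc z ^+ 2 / q.
  by rewrite normc_div normc_real gtr0_norm // expr_div_n rho2E.
have b1 : normc b <= 1.
  rewrite -(@ler_pXn2r _ 2) ?nnegrE ?normc_ge0 // nb2 expr1n ler_pdivrMr // mul1r.
  by rewrite lerDr ltW // divr_gt0.
have ub : lam 0 <= u b.
  rewrite /u bE nb2.
  have -> : rho * (1 - normc z ^+ 2 / q) * lam z = rho * ((q - normc z ^+ 2) * lam z) / q.
    by field; rewrite gt_eqF.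
  have -> : (q - normc z ^+ 2) * lam z = lam 0 by rewrite /q addrK divfK // gt_eqF.
  rewrite ler_pdivlMr // mulrC ler_pM2r // -rho2E expr2.
  by rewrite ger_pMr // ltW.
have ua : lam 0 <= u a.
  by apply: le_trans ub _; apply: amax; rewrite subr0.
(* u vanishes on the unit circle, whereas u a >= lam 0 > 0. *)
have a1' : normc a < 1.
  rewrite lt_neqAle a1 andbT; apply/eqP => a1E.
  by move: ua; rewrite /u a1E expr1n subrr mulr0 mul0r; lra.
apply: (@bloch_normalized rho a) => //.
- by rewrite rho0 ltW.
- exact: lt_le_trans ua.
- apply: le_trans l0K _; rewrite ler_wpM2r ?(ltW KK0) //.
  by rewrite ler_pXn2r ?nnegrE ?(ltW l0) //; apply: le_trans ua; exact: ltW.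
- by move=> x x1; apply: amax; rewrite subr0 ltW.
Qed.

End BlochLandau.

(** * Derivatives of harmonic elliptic maps *)

Section AlmostEverywhere.
Variable R : realType.
Local Notation C := (cplx R).

(** If v z < 0, continuity makes v negative on an open square around z; the square then lies in the
    exceptional null set although its area is positive. *)
Lemma ae_on_ge0 (v : C -> R) (P : C -> Prop) :
  (forall z, normc z < 1 -> rcont_at v z) ->
  (forall z, normc z < 1 -> P z -> 0 <= v z) ->
  ae_on (@unit_disk R) P -> forall z, normc z < 1 -> 0 <= v z.
Proof.
move=> cv Pv [N [mN N0 subN]] z z1; rewrite leNgt; apply/negP => vz.
have vz0 : 0 < - v z by rewrite oppr_gt0.
have [d d0 hd] := cv z z1 _ vz0.
have z1' : 0 < 1 - normc z by rewrite subr_gt0.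
pose e := Num.min d (1 - normc z) / 2.
have e0 : 0 < e by rewrite divr_gt0 // lt_min d0.
have ed : 2 * e <= d by rewrite /e mulrC divfK // ge_min lexx.
have ez : 2 * e <= 1 - normc z by rewrite /e mulrC divfK // ge_min lexx orbT.
have m0 : 0 < Num.min d (1 - normc z) by rewrite lt_min d0.
pose Q : set (R * R) := `]complex.Re z - e, complex.Re z + e[%classic `*`
                        `]complex.Im z - e, complex.Im z + e[%classic.
have QN : Q `<=` N.
  move=> [x y] [/=]; rewrite !in_itv /= => /andP[x1 x2] /andP[y1 y2].
  apply: subN => /= H.
  have near_z : normc ((x +i* y) - z) < 2 * e.
    apply: le_lt_trans (normc_le_ReIm _) _.
    have -> : complex.Re ((x +i* y) - z) = x - complex.Re z by case: (z).
    have -> : complex.Im ((x +i* y) - z) = y - complex.Im z by case: (z).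
    have xe : `|x - complex.Re z| < e by rewrite ltr_norml; apply/andP; split; lra.
    have ye : `|y - complex.Im z| < e by rewrite ltr_norml; apply/andP; split; lra.
    by lra.
  have xy1 : normc (x +i* y) < 1.
    have -> : x +i* y = ((x +i* y) - z) + z by rewrite subrK.
    by apply: le_lt_trans (le_normcD _ _) _; lra.
  have v0 : 0 <= v (x +i* y) by apply: Pv => //; apply: H; exact/unit_diskP.
  have := hd _ (lt_le_trans near_z ed); rewrite ltr_norml => /andP[_].
  by move: v0; lra.
have : ((@lebesgue_measure R \x @lebesgue_measure R)%E Q <=
    (@lebesgue_measure R \x @lebesgue_measure R)%E N)%E.
  apply: le_measure => //; rewrite inE //.
  by apply: measurableX; exact: measurable_itv.
rewrite N0 product_measure1E; [|exact: measurable_itv|exact: measurable_itv].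
have L (x : R) : lebesgue_measure (`]x - e, x + e[%classic : set R) = (2 * e)%:E.
  rewrite lebesgue_measure_itv /= lte_fin ifT; last by lra.
  by rewrite -EFinD; congr EFin; ring.
have -> : (lebesgue_measure
    (`](complex.Re z - e)%R, (complex.Re z + e)%R[%classic : set R) *
  lebesgue_measure
    (`](complex.Im z - e)%R, (complex.Im z + e)%R[%classic : set R) =
  (2 * e * (2 * e))%:E)%E.
  by rewrite !L EFinM.
rewrite lee_fin leNgt => /negP; apply.
by rewrite !mulr_gt0.
Qed.

End AlmostEverywhere.

(** * Wirtinger derivatives and operator norm of f = h + conj g *)

Section HarmonicDerivatives.
Variable R : realType.
Local Notation C := (cplx R).

Lemma conjc_add (x y : R[i]) : conjc (x + y) = conjc x + conjc y.
Proof. exact: rmorphD. Qed.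

Lemma conjc_mul (x y : R[i]) : conjc (x * y) = conjc x * conjc y.
Proof. exact: rmorphM. Qed.

Lemma conjc_i : conjc ('i%C : R[i]) = - 'i%C.
Proof. by apply/eqP; rewrite eq_complex /= oppr0 !eqxx. Qed.

Lemma euclidE (w : 'cV[R]_2) : euclid w = normc (w 0 0 +i* w 1 0).
Proof.
rewrite /euclid normc_sqrtE /= big_ord_recl big_ord1.
by congr (Num.sqrt (_ + w _ _ ^+ 2)); apply/val_inj.
Qed.

Lemma diff_mx_mul (f : C -> C) z (w : 'cV[R]_2) :
  let v := diff_mx f z *m w in
  (v 0 0 +i* v 1 0) = (w 0 0)%:C * cpart_x f z + (w 1 0)%:C * cpart_y f z.
Proof.
rewrite /= !mxE !big_ord_recl !big_ord0 !mxE /=.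
have -> : lift ord0 ord0 = 1 :> 'I_2 by apply/val_inj.
rewrite /cpart_x /cpart_y; apply/eqP; rewrite eq_complex /=.
by apply/andP; split; apply/eqP; ring.
Qed.

(** For |w| = 1 the equation reads w^2 = conj e. *)
Lemma sqrtc_unit (e : R[i]) : normc e = 1 ->
  exists2 w : R[i], normc w = 1 & conjc w = e * w.
Proof.
move=> e1; pose w := sqrtc (conjc e); exists w.
  apply/eqP; rewrite -(@eqrXn2 _ 2) ?normc_ge0 //.
  by rewrite expr1n -normcX sqr_sqrtc normc_conj e1.
have w2 : w ^+ 2 = conjc e by exact: sqr_sqrtc.
have ee : e * conjc e = 1 by rewrite mul_conjc e1 expr1n.
have w0 : w != 0.
  by rewrite -normc_eq0 -sqrf_eq0 -normcX w2 normc_conj e1 oner_eq0.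
have wc : w * conjc w = 1.
  have : normc w ^+ 2 = 1 by rewrite -normcX w2 normc_conj.
  by rewrite mul_conjc => ->.
by apply: (mulfI w0); rewrite wc mulrCA -expr2 w2.
Qed.

Variables (f h g h1 g1 : C -> C).
Hypothesis dh : forall x, normc x < 1 -> cderiv h x (h1 x).
Hypothesis dg : forall x, normc x < 1 -> cderiv g x (g1 x).
Hypothesis fE : forall x, normc x < 1 -> f x = h x + conjc (g x).

(** It covers all four partial derivatives: w = 1 or i chooses the direction, c = 1 or -i the real
    or the imaginary part. *)
Lemma partial_along (u : R -> R) (z w c : C) (s : R) :
  normc (z + s%:C * w) < 1 ->
  (forall y, u y = complex.Re (c * f (z + y%:C * w))) ->
  derive1 u s = complex.Re (c *
    (h1 (z + s%:C * w) * w + conjc (g1 (z + s%:C * w) * w))).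
Proof.
move=> z1 uE; rewrite derive1E.
pose k (y : R) : C := h (z + y%:C * w) + conjc (g (z + y%:C * w)).
have dk : rderiv k s (h1 (z + s%:C * w) * w + conjc (g1 (z + s%:C * w) * w)).
  by apply: rderivD; [|apply: rderiv_conj]; apply: cderiv_segment; auto.
have dRe := rderiv_is_derive c dk.
apply: (@derive_val _ _ _ _ _ _ _ (near_eq_is_derive _ dRe)).
have [d d0 hd] : exists2 d : R, 0 < d &
    forall y : R, `|y - s| < d -> normc (z + y%:C * w) < 1.
  have w1 : 0 < normc w + 1 by rewrite ltr_wpDl ?normc_ge0.
  exists ((1 - normc (z + s%:C * w)) / (normc w + 1)).
    by rewrite divr_gt0 // subr_gt0.
  move=> y; rewrite ltr_pdivlMr // => ys.
  have -> : z + y%:C * w = (z + s%:C * w) + (y - s)%:C * w by rewrite rmorphB; ring.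
  apply: le_lt_trans (le_normcD _ _) _; rewrite normcM normc_real.
  have := normr_ge0 (y - s); nra.
apply/nbhs_realP; exists d => // y /hd y1.
by rewrite uE fE.
Qed.

Lemma cpart_xE z : normc z < 1 -> cpart_x f z = h1 z + conjc (g1 z).
Proof.
move=> z1; case: z z1 => a b z1.
have zE (y : R) : (0 +i* b) + y%:C * 1 = y +i* b :> C.
  by apply/eqP; rewrite eq_complex /=; apply/andP; split; apply/eqP; ring.
have P (u : R -> R) c : (forall y, u y = complex.Re (c * f (y +i* b))) ->
    derive1 u a = complex.Re (c * (h1 (a +i* b) + conjc (g1 (a +i* b)))).
  move=> uE; have := @partial_along u (0 +i* b) 1 c a.
  rewrite zE !mulr1; apply=> // y.
  by rewrite uE zE.
rewrite /cpart_x /part_x /line_x /re_part /im_part /=.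
rewrite (P _ 1) => [|y]; last by rewrite mul1r.
rewrite (P _ (- 'i%C)) => [|y]; last first.
  by case: (f _) => p q /=; ring.
rewrite mul1r; case: (_ + _) => p q /=; congr (_ +i* _); ring.
Qed.

Lemma cpart_yE z : normc z < 1 -> cpart_y f z = 'i%C * (h1 z - conjc (g1 z)).
Proof.
move=> z1; case: z z1 => a b z1.
have zE (y : R) : a%:C + y%:C * 'i%C = a +i* y :> C.
  by apply/eqP; rewrite eq_complex /=; apply/andP; split; apply/eqP; ring.
have P (u : R -> R) c : (forall y, u y = complex.Re (c * f (a +i* y))) ->
    derive1 u b = complex.Re (c * ('i%C * (h1 (a +i* b) - conjc (g1 (a +i* b))))).
  move=> uE; have := @partial_along u a%:C 'i%C c b.
  rewrite zE => -> //; last by move=> y; rewrite uE zE.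
  by congr (complex.Re (c * _)); rewrite conjc_mul conjc_i; ring.
rewrite /cpart_y /part_y /line_y /re_part /im_part /=.
rewrite (P _ 1) => [|y]; last by rewrite mul1r.
rewrite (P _ (- 'i%C)) => [|y]; last first.
  by case: (f _) => p q /=; ring.
rewrite mul1r; case: ('i%C * _) => p q /=; congr (_ +i* _); ring.
Qed.

Lemma sqri : 'i%C * 'i%C = -1 :> R[i].
Proof. by rewrite -expr2 sqr_i. Qed.

Lemma dzE z : normc z < 1 -> dz f z = h1 z.
Proof.
by move=> z1; rewrite /dz cpart_xE // cpart_yE // mulrA sqri; field.
Qed.

Lemma dzbarE z : normc z < 1 -> dzbar f z = conjc (g1 z).
Proof.
by move=> z1; rewrite /dzbar cpart_xE // cpart_yE // mulrA sqri; field.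
Qed.

(** Let e align b = conj g' with h'. On the unit vector w with conj w = e w the differential takes
    the value (h' + e b) w, of modulus |h'| + |g'|. *)
Lemma opnorm_ge z : normc z < 1 -> normc (h1 z) + normc (g1 z) <= opnorm (diff_mx f z).
Proof.
move=> z1; pose b := conjc (g1 z).
have mulE (w : 'cV[R]_2) : euclid (diff_mx f z *m w) =
    normc (h1 z * (w 0 0 +i* w 1 0) + b * conjc (w 0 0 +i* w 1 0)).
  rewrite euclidE diff_mx_mul cpart_xE // cpart_yE // -/b.
  have -> : w 0 0 +i* w 1 0 = (w 0 0)%:C + (w 1 0)%:C * 'i%C.
    by apply/eqP; rewrite eq_complex /=; apply/andP; split; apply/eqP; ring.
  by congr normc; rewrite conjc_add conjc_mul conjc_i !conjc_real; ring.
have [e e1 eE] := align_arguments (h1 z) b.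
have [w w1 wE] := sqrtc_unit e1.
pose W : 'cV[R]_2 := \col_i (if i == 0 then complex.Re w else complex.Im w).
have WE : W 0 0 +i* W 1 0 = w by rewrite !mxE /=; case: (w).
have nW : normc (h1 z) + normc (g1 z) = euclid (diff_mx f z *m W).
  rewrite mulE WE wE.
  have -> : h1 z * w + b * (e * w) = (h1 z + e * b) * w by ring.
  by rewrite normcM w1 mulr1 eE normc_conj.
(* The supremum dominates its members only for a set bounded above; the value just attained is
   itself such a bound. *)
rewrite nW; apply: ub_le_sup.
  exists (normc (h1 z) + normc (g1 z)) => _ [V /= V1 <-].
  rewrite mulE; move: V1; rewrite euclidE; set v := _ +i* _ => v1.
  apply: le_trans (le_normcD _ _) _.
  by rewrite !normcM normc_conj v1 !mulr1 normc_conj.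
by exists W => //=; rewrite euclidE WE.
Qed.

Hypothesis C2f : C2_on (@unit_disk R) f.

Lemma unit_disk_nbhs (z : C) : normc z < 1 -> nbhs z (@unit_disk R).
Proof.
move=> z1; apply: open_nbhs_nbhs; split; first exact: disk_open.
exact/unit_diskP.
Qed.

Lemma h1E (z : C) : normc z < 1 -> \forall x \near z,
  h1 x = 2^-1 * cpart_x f x + (- 2^-1 * 'i%C) * cpart_y f x.
Proof.
move=> /unit_disk_nbhs; apply: filterS => x /unit_diskP x1.
by rewrite -(dzE x1) /dz; ring.
Qed.

Lemma g1E (z : C) : normc z < 1 -> \forall x \near z,
  g1 x = conjc (2^-1 * cpart_x f x + 2^-1 * 'i%C * cpart_y f x).
Proof.
move=> /unit_disk_nbhs; apply: filterS => x /unit_diskP x1.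
rewrite -[LHS]conjcK; congr (conjc _).
by rewrite -(dzbarE x1) /dzbar; ring.
Qed.

Lemma h1_rdiff z : normc z < 1 -> exists A B, rdiff h1 z A B.
Proof.
move=> z1; have [_ Cx Cy] := C2f; have nz := unit_disk_nbhs z1.
have [A [B dx]] := C1_rdiff nz Cx; have [A' [B' dy]] := C1_rdiff nz Cy.
have d12 := rdiffD (rdiffZ 2^-1 dx) (rdiffZ (- 2^-1 * 'i%C) dy).
do 2 eexists; exact: rdiff_near (h1E z1) d12.
Qed.

Lemma g1_rdiff z : normc z < 1 -> exists A B, rdiff g1 z A B.
Proof.
move=> z1; have [_ Cx Cy] := C2f; have nz := unit_disk_nbhs z1.
have [A [B dx]] := C1_rdiff nz Cx; have [A' [B' dy]] := C1_rdiff nz Cy.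
have d12 := rdiff_conj (rdiffD (rdiffZ 2^-1 dx) (rdiffZ (2^-1 * 'i%C) dy)).
do 2 eexists; exact: rdiff_near (g1E z1) d12.
Qed.

Lemma rdiff_cont (p : C -> C) z A B : rdiff p z A B -> cont_at p z.
Proof.
move=> dp e e0; have [d d0 hd] := dp 1 ltr01.
pose N := 1 + (normc A + normc B); have N0 : 0 < N.
  by rewrite ltr_pwDl // addr_ge0 ?normc_ge0.
exists (Num.min d (e / N)); first by rewrite lt_min d0 divr_gt0.
move=> x; rewrite lt_min ltr_pdivlMr // => /andP[xd]; apply: le_lt_trans.
have := hd _ xd; have -> : z + (x - z) = x by ring.
set L := A * _ + _ => le1.
have -> : p x - p z = (p x - p z - L) + L by ring.
apply: le_trans (le_normcD _ _) _.
apply: le_trans (lerD le1 (le_normcD _ _)) _.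
by rewrite !normcM normc_conj /N; lra.
Qed.

Lemma disk_smooth (p p1 : C -> C) :
  (forall x, normc x < 1 -> cderiv p x (p1 x)) ->
  (forall x, normc x < 1 -> exists A B, rdiff p1 x A B) ->
  forall x, normc x < 1 -> smooth 2 p x.
Proof.
move=> dp rp x x1; have [A [B dAB]] := rp x x1.
have r0 : 0 < 1 - normc x by rewrite subr_gt0.
apply: primitive_smooth r0 _ dAB => y yx; apply: dp.
have -> : y = (y - x) + x by rewrite subrK.
by apply: le_lt_trans (le_normcD _ _) _; rewrite -ltrBrDr.
Qed.

End HarmonicDerivatives.

Theorem corollary1 (R : realType) (K K' : R) (f h g : cplx R -> cplx R)
    (hK : 1 <= K) (hK' : 0 <= K')
    (hh : analytic_on (@unit_disk R) h)
    (hg : analytic_on (@unit_disk R) g)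
    (hg0 : g 0 = 0)
    (hfhg : forall z, unit_disk z -> f z = h z + conjc (g z))
    (hharm : harmonic_on (@unit_disk R) f)
    (hell : elliptic K K' f)
    (hf0 : f 0 = 0)
    (hJ : Jac f 0 = 1) :
  exists (w : cplx R) (r : R),
    rho2 K K' <= r /\ univalent_disk (@unit_disk R) f w r.
Proof.
pose h1 (z : cplx R) : cplx R := 'D_1 h z; pose g1 (z : cplx R) : cplx R := 'D_1 g z.
have dh (x : cplx R) : normc x < 1 -> cderiv h x (h1 x).
  by move=> x1; apply/derivable_cderiv/hh/unit_diskP.
have dg (x : cplx R) : normc x < 1 -> cderiv g x (g1 x).
  by move=> x1; apply/derivable_cderiv/hg/unit_diskP.
have fE (x : cplx R) : normc x < 1 -> f x = h x + conjc (g x).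
  by move=> x1; apply/hfhg/unit_diskP.
have [C2f _] := hharm.
have rh := h1_rdiff dh dg fE C2f; have rg := g1_rdiff dh dg fE C2f.
have ch (x : cplx R) : normc x < 1 -> cont_at h1 x.
  by move=> /rh[A [B]]; exact: rdiff_cont.
have cg (x : cplx R) : normc x < 1 -> cont_at g1 x.
  by move=> /rg[A [B]]; exact: rdiff_cont.
have JacE (x : cplx R) : normc x < 1 -> Jac f x =
    (normc (h1 x) + normc (g1 x)) * (normc (h1 x) - normc (g1 x)).
  move=> x1; rewrite /Jac (dzE dh dg fE x1) (dzbarE dh dg fE x1) normc_conj.
  by rewrite mulrC -subr_sqr.
have n01 : normc (0 : cplx R) < 1 by rewrite normc0.
apply: (bloch_disk hK hK' dh dg (disk_smooth dh rh) (disk_smooth dg rg) ch cg fE).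
  (* v is the slack of ellipticity with |h'| + |g'| in place of the operator norm: continuous, and
     nonnegative almost everywhere in the disk. *)
  pose L (x : cplx R) := normc (h1 x) + normc (g1 x).
  pose l (x : cplx R) := normc (h1 x) - normc (g1 x).
  pose v (x : cplx R) := K * (L x * l x) + K' - L x ^+ 2.
  have cv (x : cplx R) : normc x < 1 -> rcont_at v x.
    move=> x1; have nh := rcont_at_normc (ch x x1); have ng := rcont_at_normc (cg x x1).
    have cL := rcont_atD nh ng; have cl := rcont_atB nh ng.
    apply: rcont_atB; last exact: rcont_atX.
    apply: rcont_atD; last exact: rcont_at_cst.
    by apply: rcont_atM; [exact: rcont_at_cst|exact: rcont_atM].
  have [_ _ _ ae] := hell.
  move=> x x1; rewrite -subr_ge0; move: x x1.
  apply: ae_on_ge0 cv _ ae => x x1; rewrite JacE // => le_op.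
  rewrite /v subr_ge0; apply: le_trans le_op.
  rewrite ler_pXn2r ?nnegrE ?addr_ge0 ?normc_ge0 //.
    exact: (opnorm_ge dh dg fE x1).
  by apply: le_trans (opnorm_ge dh dg fE x1); rewrite addr_ge0 ?normc_ge0.
by rewrite -JacE.
Qed.
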